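(* Let $(\Omega,\Pi)$, $p$, $(\tau_z)_{z\in\mathbb{Z}^d}$ be a random environment on $\mathbb{Z}^d$ and $\Gamma\subseteq\mathbb{Z}^d$ a subgroup satisfying the five assumptions listed in the context (no deterministic walks; decaying transition probabilities; ergodicity with respect to $\Gamma$; partial transitivity with respect to $\Gamma$; absolutely continuous steady state $\Pi_*$). If the local drift $\mathcal{D}(\omega)=\sum_{y\in\mathbb{Z}^d}p_{0y}(\omega)\,y\in\mathbb{R}^d$ is well-defined in $L^1(\Omega,\Pi)$, then, for $\Pi$-a.e. environment $\omega\in\Omega$, $$\lim_{n\to\infty}\frac{X_n}{n}=\int_\Omega\Pi_*(d\omega')\,\mathcal{D}(\omega')$$ $P_\omega$-almost surely.
   Context: Random environment. $(\Omega,\Pi)$ is a complete probability space; for $\omega\in\Omega$, $p(\omega)=(p_{xy}(\omega))_{x,y\in\mathbb{Z}^d}$ is a transition (stochastic) matrix on $\mathbb{Z}^d$ depending measurably on $\omega$; $\mathbb{Z}^d$ acts on $\Omega$ by a group $(\tau_z)_{z\in\mathbb{Z}^d}$ of $\Pi$-automorphisms (invertible $\Pi$-preserving maps) with $p_{xy}(\tau_z\omega)=p_{x+z,y+z}(\omega)$. The dependence on $\omega$ is often omitted. $\mathbb{N}=\{0,1,2,\dots\}$. Walk. For $\omega\in\Omega$, $P_\omega$ is the law on $(\mathbb{Z}^d)^{\mathbb{N}}$ of the Markov chain $(X_n)_{n\in\mathbb{N}}$ with $P_\omega(X_0=0)=1$ and $P_\omega(X_{n+1}=y\mid X_n=x)=p_{xy}(\omega)$.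 The annealed law on $(\mathbb{Z}^d)^{\mathbb{N}}\times\Omega$ is $\mathbb{P}(E\times B)=\int_B\Pi(d\omega)P_\omega(E)$. Environment viewed from the particle (EVP): the Markov chain $(\Omega_n)_{n\in\mathbb{N}}$ on $\Omega$ with transition kernel $\mathcal{K}(\omega',B)=\sum_{y\in\mathbb{Z}^d}p_{0y}(\omega')\,1_B(\tau_y\omega')$; it is realized by $\Omega_n=\tau_{X_n}\omega$. Assumptions: - No deterministic walks: let $\Omega_{\mathrm d}$ be the set of $\omega$ for which there is $y_o\in\mathbb{Z}^d$ with $p_{0y}(\omega)=\delta_{y_oy}$ for all $y\in\mathbb{Z}^d$ ($\delta$ is the Kronecker delta). Then, $\mathbb{P}$-almost surely, $(\Omega_n)_{n\in\mathbb{N}}\not\subset\Omega_{\mathrm d}$, i.e., there is $n\in\mathbb{N}$ with $\tau_{X_n}\omega\notin\Omega_{\mathrm d}$. - Decaying transition probabilities: there exist $K,\gamma>0$ such that, almost surely, $p_{xy}\le K|y-x|^{-d-\gamma}$ (for $y=x$ the right-hand side is understood as $+\infty$). - Ergodicity: $\Gamma$ is a subgroup of $\mathbb{Z}^d$ such that $(\Omega,\Pi,(\tau_z)_{z\in\Gamma})$ is ergodic. - Partial transitivity: with the same $\Gamma$, let $\Omega_{\mathrm t}$ be the set of $\omega$ such that for every $y\in\Gamma$ there is a positive integer $n=n(\omega,y)$ with $p^{(n)}_{0y}(\omega)>0$, where $p^{(n)}_{0y}=\sum_{x_1,\dots,x_{n-1}}p_{0x_1}p_{x_1x_2}\cdots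 p_{x_{n-1}y}$. Then $\Pi(\Omega_{\mathrm t})>0$. - Absolutely continuous steady state: there is a probability measure $\Pi_*$ on $\Omega$, absolutely continuous with respect to $\Pi$, such that the EVP with initial law $\Pi_*$ is stationary, i.e., $\int_\Omega\Pi_*(d\omega')\mathcal{K}(\omega',B)=\Pi_*(B)$ for all measurable $B$; furthermore $\Pi_*(\Omega_{\mathrm t})>0$.
   Formalization: The local drift is also assumed well-defined in L^1 with respect to the steady state, i.e. the sum of p_{0y}|y| is integrable under both Pi and Pi_*; integrability under Pi alone does not ensure that the integral of D against Pi_* exists. *)

(* Defs.v *)
From HB Require Import structures.
From mathcomp Require Import all_boot all_order all_algebra.
From mathcomp Require Import all_classical all_reals all_analysis.

Set Implicit Arguments.
Unset Strict Implicit.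
Unset Printing Implicit Defensive.

Import Order.TTheory GRing.Theory Num.Theory.
Import numFieldNormedType.Exports.

Local Open Scope classical_set_scope.
Local Open Scope ring_scope.

HB.instance Definition _ := isPointed.Build int 0.

Notation lattice d := ('rV[int]_d).

Definition to_Rd (R : realType) (d : nat) (x : lattice d) : 'rV[R]_d :=
  map_mx intr x.

(* The library's norm on row vectors is the sup norm, hence this definition. *)
Definition euclid (R : realType) (d : nat) (x : lattice d) : R :=
  Num.sqrt (\sum_(i < d) (x 0 i)%:~R ^+ 2).

(* Unordered sum of an absolutely summable real family; meaningless otherwise. *)
Definition rsum (R : realType) (I : choiceType) (f : I -> R) : R :=
  fine (\esum_(i in [set: I]) ((EFin \o f)^\+ i)%E
        - \esum_(i in [set: I]) ((EFin \o f)^\- i)%E)%E.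

Record random_environment (R : realType) (d : nat) (disp : measure_display)
    (Omega : measurableType disp) (Pi : probability Omega R)
    (p : Omega -> lattice d -> lattice d -> R)
    (tau : lattice d -> Omega -> Omega) : Prop := {
  env_complete : measure_is_complete Pi ;
  env_ge0 : forall w x y, 0 <= p w x y ;
  env_sum1 : forall w x, (\esum_(y in [set: lattice d]) (p w x y)%:E = 1)%E ;
  env_measurable : forall x y, measurable_fun [set: Omega] (fun w => p w x y) ;
  env_shift0 : forall w, tau 0 w = w ;
  env_shiftD : forall y z w, tau (y + z) w = tau y (tau z w) ;
  env_shift_measurable : forall z, measurable_fun [set: Omega] (tau z) ;
  env_shift_preserves : forall z (A : set Omega), measurable A ->
    Pi (tau z @^-1` A) = Pi A ;
  env_stationary : forall z w x y, p (tau z w) x y = p w (x + z) (y + z)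
}.

(* Every subset of the countable set Z^d is measurable, so the product
   sigma-algebra on trajectories is generated by the events X_n = x. *)
Definition coord_events (d : nat) : set (set (nat -> lattice d)) :=
  [set E | exists (n : nat) (x : lattice d),
    E = [set X : nat -> lattice d | X n = x]].
Arguments coord_events : clear implicits.

Notation path_space d := (g_sigma_algebraType (coord_events d)).

(* Markov property with P(X_{n+1} = y | X_n = x) = q x y, multiplied out so as
   not to condition on null events. Since Z^d is countable, these identities
   determine the law. *)
Definition is_walk_law (R : realType) (d : nat) (q : lattice d -> lattice d -> R)
    (P : probability (path_space d) R) : Prop :=
  P [set X | X 0%N = 0] = 1%E /\
  forall (n : nat) (x : nat -> lattice d),
    P [set X | forall k : nat, (k <= n.+1)%N -> X k = x k] =
    (P [set X | forall k : nat, (k <= n)%N -> X k = x k] * (q (x n) (x n.+1))%:E)%E.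

Definition is_annealed_law (R : realType) (d : nat) (disp : measure_display)
    (Omega : measurableType disp) (Pi : probability Omega R)
    (P : Omega -> probability (path_space d) R)
    (PP : probability (path_space d * Omega)%type R) : Prop :=
  forall (E : set (path_space d)) (B : set Omega), measurable E -> measurable B ->
    PP (E `*` B) = (\int[Pi]_(w in B) P w E)%E.

Definition deterministic_envs (R : realType) (d : nat) (Omega : Type)
    (p : Omega -> lattice d -> lattice d -> R) : set Omega :=
  [set w | exists yo, forall y, p w 0 y = (yo == y)%:R].

Definition no_deterministic_walks (R : realType) (d : nat)
    (disp : measure_display) (Omega : measurableType disp)
    (p : Omega -> lattice d -> lattice d -> R)
    (tau : lattice d -> Omega -> Omega)
    (PP : probability (path_space d * Omega)%type R) : Prop :=
  {ae PP, forall Xw, exists n : nat,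
    ~ deterministic_envs p (tau ((Xw.1 : nat -> lattice d) n) Xw.2)}.

Definition decaying (R : realType) (d : nat) (disp : measure_display)
    (Omega : measurableType disp) (Pi : probability Omega R)
    (p : Omega -> lattice d -> lattice d -> R) : Prop :=
  exists K gamma : R, [/\ 0 < K, 0 < gamma &
    {ae Pi, forall w, forall x y, y != x ->
      p w x y <= K * euclid R (y - x) `^ (- d%:R - gamma)}].

Definition ergodic (R : realType) (d : nat) (disp : measure_display)
    (Omega : measurableType disp) (Pi : probability Omega R)
    (tau : lattice d -> Omega -> Omega) (Gamma : set (lattice d)) : Prop :=
  forall A : set Omega, measurable A ->
    (forall z, Gamma z -> tau z @^-1` A = A) -> Pi A = 0%E \/ Pi A = 1%E.

Fixpoint path_weight (R : realType) (d : nat) (q : lattice d -> lattice d -> R)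
    (x : lattice d) (s : seq (lattice d)) : R :=
  if s is y :: s' then q x y * path_weight q y s' else 1.

(* p^(n)_{xy} for n >= 1; the tuple lists the intermediate points
   x_1, ..., x_{n-1}. *)
Definition nstep (R : realType) (d : nat) (q : lattice d -> lattice d -> R)
    (n : nat) (x y : lattice d) : \bar R :=
  (\esum_(s in [set: n.-1.-tuple (lattice d)]) (path_weight q x (rcons s y))%:E)%E.

Definition transitive_envs (R : realType) (d : nat) (Omega : Type)
    (p : Omega -> lattice d -> lattice d -> R) (Gamma : set (lattice d)) :
    set Omega :=
  [set w | forall y, Gamma y ->
    exists n : nat, (0 < n)%N /\ (0 < nstep (p w) n 0 y)%E].

Definition partially_transitive (R : realType) (d : nat)
    (disp : measure_display) (Omega : measurableType disp)
    (Pi : probability Omega R) (p : Omega -> lattice d -> lattice d -> R)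
    (Gamma : set (lattice d)) : Prop :=
  (0 < Pi (transitive_envs p Gamma))%E.

Definition evp_kernel (R : realType) (d : nat) (Omega : Type)
    (p : Omega -> lattice d -> lattice d -> R)
    (tau : lattice d -> Omega -> Omega) (w : Omega) (B : set Omega) : \bar R :=
  (\esum_(y in [set: lattice d]) (p w 0 y * \1_B (tau y w))%:E)%E.

Record ac_steady_state (R : realType) (d : nat) (disp : measure_display)
    (Omega : measurableType disp) (Pi : probability Omega R)
    (p : Omega -> lattice d -> lattice d -> R)
    (tau : lattice d -> Omega -> Omega) (Gamma : set (lattice d))
    (Pistar : probability Omega R) : Prop := {
  steady_ac : Pistar `<< Pi ;
  steady_stationary : forall B : set Omega, measurable B ->
    (\int[Pistar]_w evp_kernel p tau w B = Pistar B)%E ;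
  steady_transitive : (0 < Pistar (transitive_envs p Gamma))%E
}.

Definition drift (R : realType) (d : nat) (Omega : Type)
    (p : Omega -> lattice d -> lattice d -> R) (w : Omega) : 'rV[R]_d :=
  \row_(i < d) rsum (fun y : lattice d => p w 0 y * to_Rd R y 0 i).

(* The series of functions w |-> p_{0y}(w) y, indexed by the unordered set Z^d,
   converges in L^1(mu; R^d). Unconditional convergence is equivalent to this
   absolute one, because all terms with y in a fixed orthant have coordinates of
   constant sign.
   Absolute continuity of a measure with respect to mu does not transfer this
   property to it when the density is unbounded. *)
Definition drift_in_L1 (R : realType) (d : nat) (disp : measure_display)
    (Omega : measurableType disp) (mu : probability Omega R)
    (p : Omega -> lattice d -> lattice d -> R) : Prop :=
  (\int[mu]_w (\esum_(y in [set: lattice d]) (p w 0 y * euclid R y)%:E) < +oo)%E.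

(* Main.v *)
Require Import Defs.
From mathcomp Require Import all_boot all_order all_algebra.
From mathcomp Require Import all_classical all_reals all_analysis.
From mathcomp Require Import measurable_realfun giry.
From mathcomp Require Import lra.

(** Let Q be the law of the trajectory averaged over Pi_*. By the Markov
    property and the stationarity of the environment viewed from the particle,
    Q is invariant under X |-> (X_{n+1} - X_1)_n, and X_n is the n-th Birkhoff
    sum of X_1 along this shift.

    Let B be closed under almost all jumps of the environment chain. By
    stationarity so is its complement, and one of the two meets Omega_t in
    positive Pi_*-measure. As the walk can visit all of Gamma from there, the
    Gamma-invariant set {tau_y w in B for all y in Gamma}, or its analogue for
    the complement, is not Pi-null, hence has full measure. Consequently
    Pi << Pi_*, and bounded harmonic functions of the environment chain are
    constant.

    For c above the mean speed in a given direction, let A be the invariant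
    event that X_n - n c is unbounded above in that direction. Then P_w(A) is
    harmonic, so it is a constant t, and the mean of X_1 - c over A is t times
    its mean over everything, a negative number. The maximal ergodic lemma makes
    it nonnegative, so t = 0; in particular no zero-one law for A is needed. *)

Set Implicit Arguments.
Unset Strict Implicit.
Unset Printing Implicit Defensive.

Import Order.TTheory GRing.Theory Num.Theory.
Import numFieldNormedType.Exports.

Local Open Scope classical_set_scope.
Local Open Scope ring_scope.

(** * Countable sums and discrete random variables *)

(** Enumerating the index type, with 0 at the integers that code nothing, turns an unordered sum
    into a series, to which measurability and monotone convergence apply. *)
Lemma esum_pickle (R : realType) (I : countType) (a : I -> \bar R) :
  (forall i, 0 <= a i)%E ->
  (\esum_(i in [set: I]) a i =
   \sum_(n <oo) (if pickle_inv n is Some i then a i else 0))%E.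
Proof.
move=> a0; pose b n := (if pickle_inv n is Some i then a i else 0)%E.
have b0 n : (0 <= b n)%E by rewrite /b; case: pickle_inv.
rewrite -/b nneseries_esumT//.
transitivity (\esum_(n in range (@pickle I)) b n)%E.
  rewrite esum_image; last by move=> x y _ _; exact: (pcan_inj (@pickleK_inv I)).
  by apply: eq_esum => i _; rewrite /b pickleK_inv.
rewrite esum_mkcond; apply: eq_esum => n _; case: ifPn => //.
rewrite notin_setE => Nn; rewrite /b; case E : pickle_inv => [i|//].
by exfalso; apply: Nn; exists i => //; have := @pickle_invK I n; rewrite E.
Qed.

Section countable_sums.
Local Open Scope ereal_scope.
Context d (T : measurableType d) (R : realType) (I : countType).
Variables (D : set T) (f : I -> T -> \bar R).
Hypothesis mD : measurable D.
Hypothesis mf : forall i, measurable_fun D (f i).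
Hypothesis f0 : forall i x, 0 <= f i x.

Let b n x := if pickle_inv n is Some i then f i x else 0.

Let mb n : measurable_fun D (b n).
Proof. by rewrite /b; case: pickle_inv => [i|]; [exact: mf|exact: measurable_cst]. Qed.

Let b0 n x : 0 <= b n x.
Proof. by rewrite /b; case: pickle_inv. Qed.

Lemma ge0_measurable_esum :
  measurable_fun D (fun x => \esum_(i in [set: I]) f i x).
Proof.
apply: (eq_measurable_fun (fun x => \sum_(n <oo) b n x)).
  by move=> x _; rewrite esum_pickle.
exact: ge0_emeasurable_sum.
Qed.

Lemma ge0_integral_esum (mu : {measure set T -> \bar R}) :
  \int[mu]_(x in D) (\esum_(i in [set: I]) f i x) =
  \esum_(i in [set: I]) \int[mu]_(x in D) f i x.
Proof.
rewrite esum_pickle; last by move=> i; exact: integral_ge0.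
under eq_integral do rewrite esum_pickle//.
rewrite (@integral_nneseries _ _ _ mu _ mD b)//.
apply: eq_eseriesr => n _; rewrite /b; case: pickle_inv => // .
by rewrite integral0.
Qed.

End countable_sums.

Lemma ge0_esumZl (R : realType) (I : countType) (k : R) (a : I -> \bar R) :
  0 <= k -> (forall i, 0 <= a i)%E ->
  (\esum_(i in [set: I]) (k%:E * a i) = k%:E * \esum_(i in [set: I]) a i)%E.
Proof.
move=> k0 a0; rewrite !esum_pickle// => [|i]; last exact: mule_ge0.
rewrite -nneseriesZl//; last by move=> n _; case: pickle_inv.
by apply: eq_eseriesr => n _; case: pickle_inv => //; rewrite mule0.
Qed.

Lemma esum_delta (R : realType) (I : choiceType) (i0 : I) (a : I -> \bar R) :
  (forall i, 0 <= a i)%E -> (forall i, i != i0 -> a i = 0%E) ->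
  (\esum_(i in [set: I]) a i = a i0)%E.
Proof.
move=> a0 ai; rewrite (esumID [set i0])// setTI esum_set1// setTI.
by rewrite esum1 ?adde0// => i /= /eqP; exact: ai.
Qed.

Lemma esum_gt0_ex (R : realType) (I : choiceType) (a : I -> \bar R) :
  (forall i, 0 <= a i)%E -> (0 < \esum_(i in [set: I]) a i)%E ->
  exists i, (0 < a i)%E.
Proof.
move=> a0; apply: contraPP => /forallNP na.
rewrite esum1 ?ltxx// => i _; apply/eqP; rewrite eq_le a0 andbT leNgt.
exact/negP.
Qed.

Lemma esum_ge_term (R : realType) (I : choiceType) (i0 : I) (a : I -> \bar R) :
  (forall i, 0 <= a i)%E -> (a i0 <= \esum_(i in [set: I]) a i)%E.
Proof.
move=> a0; rewrite (esumID [set i0])// setTI esum_set1// leeDl//.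
exact: esum_ge0.
Qed.

Lemma countable_bigcap_measurable d (T : measurableType d) (I : countType)
    (S : set I) (F : I -> set T) :
  (forall i, measurable (F i)) -> measurable (\bigcap_(i in S) F i).
Proof.
move=> mF; rewrite -[X in measurable X]setCK setC_bigcap; apply: measurableC.
rewrite bigcup_mkcond; apply: countable_bigcupT_measurable => //.
by move=> i; case: ifP => // _; exact: measurableC.
Qed.

Lemma countable_bigcup_measurable d (T : measurableType d) (I : countType)
    (S : set I) (F : I -> set T) :
  (forall i, measurable (F i)) -> measurable (\bigcup_(i in S) F i).
Proof.
move=> mF; rewrite bigcup_mkcond; apply: countable_bigcupT_measurable => //.
by move=> i; case: ifP.
Qed.

Section discrete_variable.
Local Open Scope ereal_scope.
Context d (T : measurableType d) (R : realType) (I : countType).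
Variables (mu : {measure set T -> \bar R}) (D : set T) (X : T -> I).
Hypothesis mD : measurable D.
Hypothesis mX : forall i, measurable (X @^-1` [set i]).

Lemma measurable_preimage_discrete (S : set I) : measurable (X @^-1` S).
Proof.
have -> : X @^-1` S = \bigcup_(i in S) X @^-1` [set i].
  by apply/seteqP; split=> x /=; [exists (X x)|move=> [i Si] /= ->].
exact: countable_bigcup_measurable.
Qed.

Lemma measurable_fun_discrete d' (T' : measurableType d') (phi : I -> T') :
  measurable_fun D (phi \o X).
Proof.
move=> _ Y mY; apply: measurableI => //; rewrite comp_preimage.
exact: measurable_preimage_discrete.
Qed.

(** At each point exactly one of the indicators of the level sets of [X] is nonzero, so [phi (X x)]
    is a countable sum that can be integrated term by term. *)
Lemma ge0_integral_discrete (phi : I -> \bar R) : (forall i, 0 <= phi i) ->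
  \int[mu]_(x in D) phi (X x) =
  \esum_(i in [set: I]) (phi i * mu (D `&` X @^-1` [set i])).
Proof.
move=> phi0.
transitivity (\int[mu]_(x in D) \esum_(i in [set: I])
    (phi i * (\1_(X @^-1` [set i]) x)%:E)).
  apply: eq_integral => x _; rewrite (@esum_delta _ _ (X x)).
  - by rewrite indicE mem_set ?mule1.
  - by move=> i; rewrite mule_ge0// lee_fin.
  - by move=> i /eqP iX; rewrite indicE memNset ?mule0//= => /esym.
have mi i : measurable_fun D (fun x => (\1_(X @^-1` [set i]) x)%:E : \bar R).
  by apply/measurable_EFinP; apply: measurable_indic.
rewrite ge0_integral_esum//; last 2 first.
- by move=> i; exact: measurable_funeM.
- by move=> i x; rewrite mule_ge0// lee_fin.
apply: eq_esum => i _; rewrite ge0_integralZl//.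
by rewrite integral_indic// setIC.
Qed.

Lemma measure_discrete : mu D = \esum_(i in [set: I]) mu (D `&` X @^-1` [set i]).
Proof.
have := @ge0_integral_discrete (cst 1) (fun=> lee01).
rewrite (_ : (fun x => cst 1 (X x)) = cst 1)// integral_cst// mul1e => ->.
by under eq_esum do rewrite mul1e.
Qed.

End discrete_variable.

(** * Trajectories *)

Definition cylinder (d : nat) (n : nat) (x : nat -> lattice d) :
    set (path_space d) :=
  [set X | forall k : nat, (k <= n)%N -> (X : nat -> lattice d) k = x k].

Definition visit (d : nat) (n : nat) (x : lattice d) : set (path_space d) :=
  [set X | (X : nat -> lattice d) n = x].

Section path_space.
Context (d : nat).

Lemma measurable_visit n (x : lattice d) :
  measurable (visit n x).
Proof. by apply: sub_sigma_algebra; exists n, x. Qed.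

Lemma measurable_cylinder n (x : nat -> lattice d) : measurable (cylinder n x).
Proof.
rewrite (_ : cylinder n x = \bigcap_(k in [set k : nat | (k <= n)%N])
  visit k (x k)); last by apply/seteqP; split.
by apply: countable_bigcap_measurable => k; exact: measurable_visit.
Qed.

(** The empty set is adjoined so that the family is stable under intersection. *)
Let cylinders : set (set (path_space d)) :=
  [set E | E = set0 \/ exists n x, E = cylinder n x].

(** If the two prefixes agree up to the shorter length, the cylinders are nested; otherwise they are
    disjoint. *)
Lemma cylinderI n m (x y : nat -> lattice d) : (n <= m)%N ->
  cylinders (cylinder n x `&` cylinder m y).
Proof.
move=> nm; have [xy|xy] := pselect (forall k, (k <= n)%N -> x k = y k).
  right; exists m, y; apply/seteqP; split => [X []//|X Xy]; split => // k kn.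
  by rewrite xy// Xy// (leq_trans kn).
left; rewrite -subset0 => X [Xx Xy]; apply: xy => k kn.
by rewrite -Xx// Xy// (leq_trans kn).
Qed.

Lemma path_space_measurableE : @measurable _ (path_space d) = <<s cylinders >>.
Proof.
apply/seteqP; split.
  apply: smallest_sub; first exact: smallest_sigma_algebra.
  move=> _ [n [x ->]].
  (* Finite sequences, extended by 0, provide countably many prefixes, enough to cover the event
     that the position at time [n] is [x]. *)
  rewrite (_ : [set X | _] = \bigcup_(s in [set s : seq (lattice d) |
      nth 0 s n = x]) cylinder n (nth 0 s)).
    rewrite bigcup_mkcond.
    apply: (@countable_bigcupT_measurable _ (g_sigma_algebraType cylinders)) => //.
    move=> s; case: ifPn => // _; apply: sub_sigma_algebra.
    by right; exists n, (nth 0 s).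
  apply/seteqP; split=> [X /= Xn|X [s /= <-]]; last exact.
  exists (mkseq X n.+1); first by rewrite /= nth_mkseq.
  by move=> k kn; rewrite nth_mkseq.
apply: smallest_sub; first exact: sigma_algebra_measurable.
by move=> _ [->//|[n [x ->]]]; exact: measurable_cylinder.
Qed.

(** Dynkin's pi-lambda theorem for the generating family of cylinders; the empty set is reached as
    the complement of the whole space. *)
Lemma cylinder_induction (Pr : set (path_space d) -> Prop) :
  Pr setT -> (forall n x, Pr (cylinder n x)) ->
  (forall S, measurable S -> Pr S -> Pr (~` S)) ->
  (forall F : (set (path_space d))^nat, (forall n, measurable (F n)) ->
    trivIset [set: nat] F -> (forall n, Pr (F n)) -> Pr (\bigcup_k F k)) ->
  forall S, measurable S -> Pr S.
Proof.
move=> PT Pcyl PC PU; rewrite path_space_measurableE.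
apply: (dynkin_induction path_space_measurableE) => //.
- move=> _ _ [->|[n [x ->]]] [->|[m [y ->]]]; rewrite ?setI0 ?set0I; try by left.
  have [|/ltnW] := leqP n m; first exact: cylinderI.
  by rewrite setIC; exact: cylinderI.
- move=> _ [->|[n [x ->]]]; last exact: Pcyl.
  by rewrite -setCT; exact: PC.
Qed.

(** The trajectory seen from the walker after one step. Subtracting the position at time 1 restarts
    it at the origin, in the environment shifted by that position. *)
Definition path_shift (X : path_space d) : path_space d :=
  fun n => (X : nat -> lattice d) n.+1 - (X : nat -> lattice d) 1%N.

Lemma measurable_path_space_fun d' (T : measurableType d')
    (f : T -> path_space d) :
  (forall n x, measurable (f @^-1` visit n x)) ->
  measurable_fun [set: T] f.
Proof.
move=> mf; apply: (@measurability _ _ T (path_space d) setT f (coord_events d) (erefl _)).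
by move=> _ [_ [n [x ->]] <-]; rewrite setTI; exact: mf.
Qed.

Lemma measurable_pair_coord n m (f : lattice d -> lattice d -> lattice d) x :
  measurable ([set X : nat -> lattice d | f (X n) (X m) = x]
    : set (path_space d)).
Proof.
rewrite (_ : [set X | _] = \bigcup_(y in [set y | f y.1 y.2 = x])
  ([set X : nat -> lattice d | X n = y.1] `&`
   [set X : nat -> lattice d | X m = y.2])).
  apply: countable_bigcup_measurable => y.
  by apply: measurableI; exact: measurable_visit.
apply/seteqP; split=> [X /= Xx|X [y /= <-] [-> ->]//].
by exists (X n, X m).
Qed.

Lemma measurable_path_shift : measurable_fun [set: path_space d] path_shift.
Proof.
apply: measurable_path_space_fun => n x.
exact: (measurable_pair_coord n.+1 1 (fun a b => a - b)).
Qed.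

End path_space.

(** * Law of the walk and its Markov property *)

Section walk_law.
Local Open Scope ereal_scope.
Context (R : realType) (d : nat) (q : lattice d -> lattice d -> R).
Variable P : probability (path_space d) R.
Hypothesis lawP : is_walk_law q P.

Lemma walk_start x : P (visit 0 x) = (x == 0%R)%:R%:E.
Proof.
have [->|x0] := eqVneq x 0%R; first by case: lawP.
apply/eqP; rewrite eq_le measure_ge0 andbT.
apply: (@le_trans _ _ (P (~` visit 0 (0%R : lattice d)))).
  apply: le_measure; rewrite ?inE; [exact: measurable_visit| |].
    by apply: measurableC; exact: measurable_visit.
  by move=> X; rewrite /visit/= => ->; apply/eqP.
have := probability_setC P (measurable_visit 0 (0%R : lattice d)).
by rewrite (proj1 lawP) subee// => ->.
Qed.

Lemma walk_cylinder n (x : nat -> lattice d) :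
  P (cylinder n x) =
  ((x 0%N == 0%R)%:R * \prod_(i < n) q (x i) (x i.+1))%:E.
Proof.
elim: n => [|n IHn].
  rewrite big_ord0 mulr1 -walk_start; congr (P _).
  apply/seteqP; split => [X Xx|X /= X0 k]; first exact: Xx.
  by rewrite leqn0 => /eqP ->.
by rewrite /cylinder (proj2 lawP) -/(cylinder n x) IHn big_ord_recr/= mulrA EFinM.
Qed.

(** Cylinders also prescribe the position at time 0; intersecting with the sure start at the origin
    turns events on later times into cylinders. *)
Lemma walk_start_ae (E : set (path_space d)) : measurable E ->
  P E = P (E `&` visit 0 0%R).
Proof.
move=> mE; have m0 := measurable_visit 0 (0%R : lattice d).
rewrite -[in LHS](setUIDK E (visit 0 0%R)).
rewrite measureU//; [|exact: measurableI|exact: measurableD|]; last first.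
  by rewrite setDE setIACA setICr setI0.
rewrite [X in _ + X](_ : _ = 0) ?adde0//.
apply: (@subset_measure0 _ _ _ P _ (~` visit 0 0%R)).
- exact: measurableD.
- exact: measurableC.
- by move=> X [].
by have := probability_setC P m0; rewrite (proj1 lawP) subee.
Qed.

Lemma walk_step y : P (visit 1 y) = (q 0%R y)%:E.
Proof.
rewrite walk_start_ae; last exact: measurable_visit.
pose x k : lattice d := if k is k'.+1 then y else 0%R.
rewrite (_ : _ `&` _ = cylinder 1 x).
  by rewrite walk_cylinder big_ord_recr big_ord0 /= eqxx !mul1r.
apply/seteqP; split => [X [/= X1 X0] [|[|]]//|X Xx].
by split; exact: Xx.
Qed.

End walk_law.

Section walk_in_environment.
Local Open Scope ereal_scope.
Context (R : realType) (d : nat) (disp : measure_display)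
  (Omega : measurableType disp) (Pi : probability Omega R)
  (p : Omega -> lattice d -> lattice d -> R)
  (tau : lattice d -> Omega -> Omega)
  (P : Omega -> probability (path_space d) R).
Hypothesis env : random_environment Pi p tau.
Hypothesis lawP : forall w, is_walk_law (p w) (P w).

Lemma measurable_walk_law E : measurable E ->
  measurable_fun [set: Omega] (fun w => P w E).
Proof.
move: E; apply: cylinder_induction.
- apply: (eq_measurable_fun (cst 1)); last exact: measurable_cst.
  by move=> w _; rewrite probability_setT.
- move=> n x; apply: (eq_measurable_fun (fun w =>
    ((x 0%N == 0%R)%:R * \prod_(i < n) p w (x i) (x i.+1))%:E)).
    by move=> w _; rewrite (walk_cylinder (lawP w)).
  apply/measurable_EFinP; apply: measurable_funM; first exact: measurable_cst.
  by apply: measurable_prod => i _; exact: (env_measurable env).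
- move=> S mS mPS; apply: (eq_measurable_fun (fun w => 1 - P w S)).
    by move=> w _; rewrite probability_setC.
  by apply: emeasurable_funB => //; exact: measurable_cst.
- move=> F mF tF mPF.
  apply: (eq_measurable_fun (fun w => \sum_(n <oo) P w (F n))).
    by move=> w _; rewrite measure_bigcup//=; apply: eq_eseriesl => n; rewrite in_setT.
  by apply: ge0_emeasurable_sum.
Qed.

(** On cylinders both sides are products of transition probabilities, which agree because those of
    [tau y w] are those of [w] translated by [y]. Both sides are finite and countably additive in
    [E], so cylinder induction concludes. *)
Lemma walk_markov w y E : measurable E ->
  P w (visit 1 y `&` @path_shift d @^-1` E) = (p w 0%R y)%:E * P (tau y w) E.
Proof.
have m1 : measurable (visit 1 y) by exact: measurable_visit.
have mshift S : measurable S -> measurable (@path_shift d @^-1` S).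
  by move=> mS; rewrite -[X in measurable X]setTI; exact: measurable_path_shift.
have P1 : P w (visit 1 y) = (p w 0%R y)%:E.
  exact: walk_step (lawP w) _.
move: E; apply: cylinder_induction.
- by rewrite preimage_setT setIT P1 probability_setT mule1.
- move=> n x; rewrite (walk_cylinder (lawP _)).
  (* A shifted trajectory is at 0 at time 0, so both sides vanish if [x] starts elsewhere. *)
  have [x0|x0] := eqVneq (x 0%N) 0%R; last first.
    rewrite mul0r mule0 [X in P w X](_ : _ = set0) ?measure0//.
    rewrite -subset0 => X [/= X1 /(_ 0%N (leq0n _))]; rewrite /path_shift subrr.
    by move=> x0'; rewrite -x0' eqxx in x0.
  (* The prefix that starts at the origin, jumps to [y], and then follows [x] translated by [y]. *)
  pose z k : lattice d := if k is k'.+1 then (x k' + y)%R else 0%R.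
  rewrite (walk_start_ae (lawP w)); last first.
    by apply: measurableI => //; apply: mshift; exact: measurable_cylinder.
  rewrite (_ : _ `&` _ = cylinder n.+1 z).
    rewrite (walk_cylinder (lawP w)) /= eqxx !mul1r big_ord_recl/= x0 add0r EFinM.
    congr (_ * _%:E); apply: eq_bigr => i _.
    by rewrite (env_stationary env).
  apply/seteqP; split => [X [[/= X1 Xx] X0] [|k]//|X Xz].
    by rewrite ltnS => kn; rewrite /= -(Xx k kn : path_shift X k = x k)
      /path_shift (X1 : (X : nat -> lattice d) 1%N = y) subrK.
  have X1 : (X : nat -> lattice d) 1%N = y by rewrite (Xz 1%N)//= x0 add0r.
  split; last exact: Xz 0%N _.
  by split => //= k kn; rewrite /path_shift X1 (Xz k.+1)//= addrK.
- move=> S mS IH.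
  rewrite (_ : _ `&` _ = visit 1 y `\` (@path_shift d @^-1` S)); last by rewrite setDE.
  rewrite measureD; [|exact: m1|exact: mshift|]; last first.
    by rewrite -ge0_fin_numE ?fin_num_measure.
  transitivity ((p w 0%R y)%:E - (p w 0%R y)%:E * P (tau y w) S).
    by congr (_ - _).
  by rewrite probability_setC// muleBr ?mule1// fin_num_adde_defr.
- move=> F mF tF IH; rewrite preimage_bigcup setI_bigcupr.
  rewrite !measure_bigcup//; last 2 first.
  + by move=> i _; apply: measurableI => //; exact: mshift.
  + apply/trivIsetP => i j _ _ ij; rewrite setIACA -preimage_setI.
    by move/trivIsetP : tF => ->//; rewrite preimage_set0 setI0.
  rewrite -nneseriesZl//; first by apply: eq_eseriesr => i _; exact: IH.
Qed.

End walk_in_environment.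

(** * The environment viewed from the particle *)

Lemma giry_bindE d1 d2 (T1 : measurableType d1) (T2 : measurableType d2)
    (R : realType) (mu : giry T1 R) (f : T1 -> giry T2 R)
    (mf : measurable_fun [set: T1] f) (S : set T2) : measurable S ->
  (giry_bind mu mf S = \int[mu]_x f x S)%E.
Proof.
move=> mS; transitivity (giry_int (giry_bind mu mf) (EFin \o \1_S)).
  by rewrite /giry_int integral_indic// setIT.
rewrite giry_int_bind.
- by apply: eq_integral => x _; rewrite /giry_int integral_indic// setIT.
- by apply/measurable_EFinP; exact: measurable_indic.
- by move=> x; rewrite lee_fin.
Qed.

(** The Markov operator of the environment viewed from the particle, called K below; on indicators
    it is [evp_kernel]. *)
Definition evp_op (R : realType) (d : nat) (Omega : Type)
    (p : Omega -> lattice d -> lattice d -> R)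
    (tau : lattice d -> Omega -> Omega) (g : Omega -> \bar R) (w : Omega) :
    \bar R :=
  (\esum_(y in [set: lattice d]) ((p w 0 y)%:E * g (tau y w)))%E.

Section steady_state.
Local Open Scope ereal_scope.
Context (R : realType) (d : nat) (disp : measure_display)
  (Omega : measurableType disp) (Pi : probability Omega R)
  (p : Omega -> lattice d -> lattice d -> R)
  (tau : lattice d -> Omega -> Omega)
  (Pistar : probability Omega R)
  (P : Omega -> probability (path_space d) R).
Hypothesis env : random_environment Pi p tau.
Hypothesis lawP : forall w, is_walk_law (p w) (P w).
Hypothesis stat : forall B : set Omega, measurable B ->
    \int[Pistar]_w evp_kernel p tau w B = Pistar B.

Lemma measurable_jump y (g : Omega -> \bar R) : measurable_fun [set: Omega] g ->
  measurable_fun [set: Omega] (fun w => (p w 0%R y)%:E * g (tau y w)).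
Proof.
move=> mg; apply: emeasurable_funM.
  by apply/measurable_EFinP; exact: (env_measurable env).
by apply: (measurableT_comp mg); exact: (env_shift_measurable env).
Qed.

Lemma jump_ge0 y (g : Omega -> \bar R) w : (forall w, 0 <= g w) ->
  0 <= (p w 0%R y)%:E * g (tau y w).
Proof. by move=> g0; rewrite mule_ge0// lee_fin (env_ge0 env). Qed.

Lemma measurable_evp_op (g : Omega -> \bar R) :
  measurable_fun [set: Omega] g -> (forall w, 0 <= g w) ->
  measurable_fun [set: Omega] (evp_op p tau g).
Proof.
move=> mg g0; apply: ge0_measurable_esum => // [y|y w].
- exact: measurable_jump.
- exact: jump_ge0.
Qed.

Lemma evp_op_ge0 (g : Omega -> \bar R) w : (forall w, 0 <= g w) ->
  0 <= evp_op p tau g w.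
Proof. by move=> g0; apply: esum_ge0 => y _; exact: jump_ge0. Qed.

Lemma evp_kernelE w B : evp_kernel p tau w B = evp_op p tau (EFin \o \1_B) w.
Proof. by []. Qed.

Lemma walk_integral_step w (phi : lattice d -> \bar R) : (forall y, 0 <= phi y) ->
  \int[P w]_X phi ((X : nat -> lattice d) 1%N) =
  \esum_(y in [set: lattice d]) ((p w 0%R y)%:E * phi y).
Proof.
move=> phi0; rewrite (@ge0_integral_discrete _ _ _ _ (P w) setT
  (fun X : path_space d => (X : nat -> lattice d) 1%N))//; last first.
  exact: measurable_visit.
apply: eq_esum => y _; rewrite muleC; congr (_ * _).
by rewrite setTI; exact: (walk_step (lawP w)).
Qed.

Let next w (X : path_space d) : Omega := tau ((X : nat -> lattice d) 1%N) w.

Let measurable_next w : measurable_fun [set: path_space d] (next w).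
Proof.
apply: (@measurable_fun_discrete _ _ _ _
  (fun X : path_space d => (X : nat -> lattice d) 1%N) _ _ _ _ (tau^~ w)) => //.
exact: measurable_visit.
Qed.

(** As the image of [P w] under the first jump, the transition kernel is a probability measure at
    once, and stationarity becomes a statement on the monadic bind. *)
Let kernel w : giry Omega R := giry_map (measurable_next w) (P w : giry _ R).

Let kernel_integral w (g : Omega -> \bar R) :
  measurable_fun [set: Omega] g -> (forall w, 0 <= g w) ->
  \int[kernel w]_w' g w' = evp_op p tau g w.
Proof.
move=> mg g0; rewrite -[LHS]/(giry_int _ _) giry_int_map// /giry_int /=.
by rewrite (walk_integral_step _ (phi := fun y => g (tau y w))).
Qed.

Let kernelE w B : measurable B -> kernel w B = evp_kernel p tau w B.
Proof.
move=> mB; rewrite evp_kernelE -kernel_integral//.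
- by rewrite integral_indic// setIT.
- by apply/measurable_EFinP; exact: measurable_indic.
- by move=> ?; rewrite lee_fin.
Qed.

Let measurable_kernel : measurable_fun [set: Omega] kernel.
Proof.
apply: measurable_giry_codensity => // B mB.
apply: (eq_measurable_fun (evp_op p tau (EFin \o \1_B))).
  by move=> w _; rewrite kernelE.
apply: measurable_evp_op.
- by apply/measurable_EFinP; exact: measurable_indic.
- by move=> ?; rewrite lee_fin.
Qed.

(** Stationarity on events says that [Pistar] bound to the kernel is [Pistar] again; it remains to
    integrate [g] against both measures. *)
Lemma integral_evp_op (g : Omega -> \bar R) :
  measurable_fun [set: Omega] g -> (forall w, 0 <= g w) ->
  \int[Pistar]_w evp_op p tau g w = \int[Pistar]_w g w.
Proof.
move=> mg g0.
transitivity (\int[giry_bind (Pistar : giry _ R) measurable_kernel]_w g w).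
  rewrite -[RHS]/(giry_int _ _) giry_int_bind//; apply: eq_integral => w _.
  by rewrite /giry_int kernel_integral.
apply: eq_measure_integral => B mB _.
transitivity (\int[Pistar]_w kernel w B); first exact: giry_bindE.
transitivity (\int[Pistar]_w evp_kernel p tau w B); last exact: stat.
by apply: eq_integral => w _; rewrite kernelE.
Qed.

Lemma walk_law_shift w E : measurable E ->
  P w (@path_shift d @^-1` E) = evp_op p tau (fun w' => P w' E) w.
Proof.
move=> mE; have mS : measurable (@path_shift d @^-1` E).
  by rewrite -[X in measurable X]setTI; exact: measurable_path_shift.
rewrite (@measure_discrete _ _ _ _ (P w) _
  (fun X : path_space d => (X : nat -> lattice d) 1%N) mS); last first.
  exact: measurable_visit.
apply: eq_esum => y _; rewrite setIC.
exact: (walk_markov env lawP).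
Qed.

Lemma measurable_walk_giry :
  measurable_fun [set: Omega] (fun w => P w : giry _ R).
Proof.
by apply: measurable_giry_codensity => // E mE; exact: (measurable_walk_law env lawP).
Qed.

Definition averaged_law : giry (path_space d) R :=
  giry_bind (Pistar : giry _ R) measurable_walk_giry.

Lemma averaged_lawE E : measurable E -> averaged_law E = \int[Pistar]_w P w E.
Proof. exact: giry_bindE. Qed.

(** Shifting the trajectory replaces the function [P w E] of [w] by its image under K, which has the
    same [Pistar]-integral. *)
Lemma averaged_law_shift E : measurable E ->
  averaged_law (@path_shift d @^-1` E) = averaged_law E.
Proof.
move=> mE; have mS : measurable (@path_shift d @^-1` E).
  by rewrite -[X in measurable X]setTI; exact: measurable_path_shift.
rewrite !averaged_lawE//.
transitivity (\int[Pistar]_w evp_op p tau (fun w' => P w' E) w).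
  by apply: eq_integral => w _; exact: walk_law_shift.
by apply: integral_evp_op => //; exact: (measurable_walk_law env lawP).
Qed.

End steady_state.

(** * Ergodicity of the environment chain *)

Lemma ge0_integral_eq0_ae d (T : measurableType d) (R : realType)
    (mu : {measure set T -> \bar R}) (D : set T) (f : T -> \bar R) :
  measurable D -> measurable_fun D f -> (forall x, D x -> 0 <= f x)%E ->
  (\int[mu]_(x in D) f x <= 0)%E -> {ae mu, forall x, D x -> f x = 0%E}.
Proof.
move=> mD mf f0 If; have := (ae_eq_integral_abs mu mD mf).1; apply.
apply/eqP; rewrite eq_le integral_ge0// andbT (le_trans _ If)//.
by under eq_integral => x /[!inE] Dx do rewrite gee0_abs ?f0//.
Qed.

Lemma ae_probability1 d (T : measurableType d) (R : realType)
    (mu : probability T R) (B : set T) : measurable B ->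
  {ae mu, forall x, B x} <-> mu B = 1%E.
Proof.
move=> mB; have mC : measurable (~` B) by exact: measurableC.
split => [aeB|B1].
  by rewrite -[B]setCK probability_setC// (measure_negligible mC aeB) sube0.
by exists (~` B); split => //; rewrite probability_setC// B1 subee.
Qed.

Lemma null_dominates_measurable d (T : measurableType d) (R : realType)
    (mu nu : probability T R) (A : set T) :
  nu `<< mu -> measurable A -> mu A = 0%E -> nu A = 0%E.
Proof.
move=> numu mA A0; apply: (numu A) => // B mB BA.
exact: subset_measure0 mB mA BA A0.
Qed.

Section environment_ergodicity.
Local Open Scope ereal_scope.
Context (R : realType) (d : nat) (disp : measure_display)
  (Omega : measurableType disp) (Pi : probability Omega R)
  (p : Omega -> lattice d -> lattice d -> R)
  (tau : lattice d -> Omega -> Omega)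
  (Gamma : set (lattice d))
  (Pistar : probability Omega R)
  (P : Omega -> probability (path_space d) R).
Hypothesis env : random_environment Pi p tau.
Hypothesis lawP : forall w, is_walk_law (p w) (P w).
Hypothesis Gamma_subgroup : zmod_closed (mem Gamma).
Hypothesis erg : ergodic Pi tau Gamma.
Hypothesis steady : ac_steady_state Pi p tau Gamma Pistar.

Local Notation K := (evp_op p tau).

Lemma measurable_path_weight x s :
  measurable_fun [set: Omega] (fun w => path_weight (p w) x s).
Proof.
elim: s x => [x|y s IHs x] /=; first exact: measurable_cst.
by apply: measurable_funM => //; exact: (env_measurable env).
Qed.

Lemma path_weight_ge0 w x s : (0 <= path_weight (p w) x s)%R.
Proof.
by elim: s x => [x|y s IHs x] //=; rewrite mulr_ge0// (env_ge0 env).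
Qed.

Lemma measurable_transitive_envs : measurable (transitive_envs p Gamma).
Proof.
rewrite (_ : transitive_envs p Gamma = \bigcap_(y in Gamma)
    \bigcup_(n in [set n : nat | (0 < n)%N]) [set w | 0 < nstep (p w) n 0%R y]).
  apply: countable_bigcap_measurable => y.
  apply: countable_bigcup_measurable => n.
  rewrite -[X in measurable X]setTI; apply: emeasurable_fun_o_infty => //.
  apply: ge0_measurable_esum => // [s|s w].
    by apply/measurable_EFinP; exact: measurable_path_weight.
  by rewrite lee_fin path_weight_ge0.
apply/seteqP; split => w wt y /wt.
  by move=> [n [n0 pn]]; exists n.
by move=> [n n0 pn]; exists n.
Qed.

(** Closure without an exceptional set can be iterated along paths of any length. The almost sure
    version below is the one that stationarity yields; [jump_closed_core] passes from it to this
    one. *)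
Definition jump_closed (C : set Omega) :=
  forall w, C w -> forall y, (0 < p w 0 y)%R -> C (tau y w).

Definition ae_jump_closed (B : set Omega) :=
  {ae Pistar, forall w, B w -> forall y, (0 < p w 0 y)%R -> B (tau y w)}.

Lemma jump_closed_path C w x s y : jump_closed C -> C (tau x w) ->
  (0 < path_weight (p w) x (rcons s y))%R -> C (tau y w).
Proof.
move=> Ccl; elim: s x => [|z s IHs] x Cx /=.
  rewrite mulr1 => pxy; rewrite -[y](subrK x) (env_shiftD env); apply: Ccl => //.
  by rewrite (env_stationary env) add0r subrK.
have [pxz|] := ltP 0%R (p w x z); last first.
  by move=> /mulr_le0_ge0 /(_ (path_weight_ge0 w z (rcons s y)))/le_gtF ->.
rewrite pmulr_rgt0//; apply: IHs.
rewrite -[z](subrK x) (env_shiftD env); apply: Ccl => //.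
by rewrite (env_stationary env) add0r subrK.
Qed.

Lemma jump_closed_transitive C w y : jump_closed C -> C w ->
  transitive_envs p Gamma w -> Gamma y -> C (tau y w).
Proof.
move=> Ccl Cw wt /wt[n [_ /esum_gt0_ex[s|s]]].
  by rewrite lee_fin path_weight_ge0.
rewrite lte_fin; apply: jump_closed_path => //.
by rewrite (env_shift0 env).
Qed.

(** From a point of [C] in Omega_t every Gamma-translate is reached without leaving [C]. So the
    Gamma-invariant event [A] that the whole Gamma-orbit lies in [C] has positive [Pistar]-mass,
    hence is not [Pi]-null, and ergodicity gives it full mass. As 0 is in Gamma, [A] lies in [C]. *)
Lemma jump_closed_full C : measurable C -> jump_closed C ->
  0 < Pistar (C `&` transitive_envs p Gamma) -> Pi C = 1.
Proof.
move=> mC Ccl CT; pose A := \bigcap_(y in Gamma) (tau y @^-1` C).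
have mA : measurable A.
  apply: countable_bigcap_measurable => y; rewrite -[X in measurable X]setTI.
  exact: (env_shift_measurable env).
have [G0 GB] := Gamma_subgroup.
have GN z : Gamma z -> Gamma (- z)%R.
  by move=> Gz; have := GB 0%R z G0; rewrite sub0r !inE; apply.
have GD y z : Gamma y -> Gamma z -> Gamma (y + z)%R.
  move=> Gy /GN Gz; have := GB y (- z)%R; rewrite opprK !inE; exact.
have Ainv z : Gamma z -> tau z @^-1` A = A.
  move=> Gz; apply/seteqP; split => w Aw y Gy /=.
    rewrite -[y](subrK z) (env_shiftD env); apply: Aw.
    by apply: GD => //; exact: GN.
  by rewrite -(env_shiftD env); apply: Aw; exact: GD.
have CA : C `&` transitive_envs p Gamma `<=` A.
  by move=> w [Cw wt] y Gy; exact: jump_closed_transitive.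
have [A0|A1] := erg mA Ainv.
  have : Pistar A = 0 by exact: null_dominates_measurable (steady_ac steady) mA A0.
  move=> A0'; have : Pistar (C `&` transitive_envs p Gamma) <= Pistar A.
    apply: le_measure; rewrite ?inE//; apply: measurableI => //.
    exact: measurable_transitive_envs.
  by rewrite A0' leNgt CT.
apply/eqP; rewrite eq_le probability_le1//= -A1 le_measure ?inE// => w Aw.
by rewrite -(env_shift0 env w); apply: Aw; rewrite inE in G0.
Qed.

Let stat := steady_stationary steady.

(** For a null set [N], stationarity makes the integral of K applied to its indicator zero. So
    almost surely every term of that sum vanishes, and no possible jump leads into [N]. *)
Lemma ae_jump (Q : Omega -> Prop) : {ae Pistar, forall w, Q w} ->
  {ae Pistar, forall w, forall y, (0 < p w 0 y)%R -> Q (tau y w)}.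
Proof.
move=> [N [mN N0 QN]].
have m1 : measurable_fun [set: Omega] (EFin \o \1_N : Omega -> \bar R).
  by apply/measurable_EFinP; exact: measurable_indic.
have pos1 w : 0 <= (EFin \o \1_N) w :> \bar R by rewrite lee_fin.
have : {ae Pistar, forall w, setT w -> K (EFin \o \1_N) w = 0}.
  apply: ge0_integral_eq0_ae => //.
  - exact: (measurable_evp_op env).
  - by move=> w _; exact: (evp_op_ge0 env).
  - rewrite (integral_evp_op env lawP stat)// integral_indic// setIT.
    by rewrite le_eqVlt; apply/orP; left; exact/eqP.
apply: filterS => w /(_ I) Kw y py; apply: contrapT => nQ.
have : (p w 0 y)%:E * (EFin \o \1_N) (tau y w) <= K (EFin \o \1_N) w.
  apply: (esum_ge_term y) => z.
  exact: (jump_ge0 env).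
rewrite Kw /= indicE mem_set ?mule1 ?lee_fin; last exact: QN.
by rewrite leNgt py.
Qed.

(** Remove from [B] all environments from which the exceptional set is reachable in finitely many
    jumps. By [ae_jump] and induction on the number of jumps, only a null set is lost. *)
Lemma jump_closed_core B : measurable B -> ae_jump_closed B ->
  exists C, [/\ measurable C, jump_closed C, C `<=` B & {ae Pistar, forall w, B w -> C w}].
Proof.
move=> mB [N [mN N0 BN]].
(* [bad k] collects the environments from which [N] can be reached in [k] jumps. *)
pose bad := fix bad k := if k is k'.+1 then
  \bigcup_(y in setT) ([set w | 0 < p w 0 y]%R `&` tau y @^-1` bad k') else N.
have mbad k : measurable (bad k).
  elim: k => [//|k IHk] /=; apply: countable_bigcup_measurable => y.
  apply: measurableI.
    rewrite -[X in measurable X]setTI -preimage_itvoy.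
    exact: (env_measurable env).
  by rewrite -[X in measurable X]setTI; exact: (env_shift_measurable env).
have bad0 k : {ae Pistar, forall w, ~ bad k w}.
  elim: k => [|k IHk]; first by exists N; split => // w /contrapT.
  by apply: filterS (ae_jump IHk) => w bw [y _ [py]]; exact: bw.
exists (B `\` \bigcup_k bad k); split.
- by apply: measurableD => //; exact: bigcupT_measurable.
- move=> w [Bw nbw] y py; split.
    have : ~ N w by move=> Nw; apply: nbw; exists 0%N.
    by apply: contra_notP => nB; apply: BN => /(_ Bw y py).
  by move=> [k _ bk]; apply: nbw; exists k.+1 => //; exists y.
- by move=> w [].
- apply: filterS (ae_foralln bad0) => w nb Bw; split => // -[k _].
  exact: nb.
Qed.

Lemma ae_jump_closed_full B : measurable B -> ae_jump_closed B ->
  0 < Pistar (B `&` transitive_envs p Gamma) -> Pi B = 1.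
Proof.
move=> mB Bcl BT; have [C [mC Ccl CB aeC]] := jump_closed_core mB Bcl.
have mT := measurable_transitive_envs.
have mCT : measurable (C `&` transitive_envs p Gamma) by exact: measurableI.
have mBT : measurable (B `&` transitive_envs p Gamma) by exact: measurableI.
have : Pi C = 1.
  apply: jump_closed_full => //; rewrite lt0e measure_ge0 andbT.
  apply/negP => /eqP CT0; move: BT; rewrite lt0e => /andP[/eqP + _]; apply.
  apply: measure_negligible => //.
  have : {ae Pistar, forall w, ~ (C `&` transitive_envs p Gamma) w}.
    by exists (C `&` transitive_envs p Gamma); split => // w /contrapT.
  move=> aeCT.
  suff : {ae Pistar, forall w, ~ (B `&` transitive_envs p Gamma) w}.
    by apply: negligibleS => w BTw /=; exact.
  by apply: filterS2 aeC aeCT => w BC nCT [Bw wt]; apply: nCT; split => //; exact: BC.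
move=> C1; apply/eqP; rewrite eq_le probability_le1//= -C1.
by apply: le_measure; rewrite ?inE.
Qed.

(* Stationarity gives [g] and [K g] the same integral, so [g <= K g] forces
   [K g = g] almost everywhere. *)
Lemma subharmonic_zero (g : Omega -> \bar R) :
  measurable_fun [set: Omega] g -> (forall w, 0 <= g w) ->
  \int[Pistar]_w g w < +oo -> {ae Pistar, forall w, g w <= K g w} ->
  ae_jump_closed [set w | g w = 0].
Proof.
move=> mg g0 Ig gK; pose Z := [set w | g w = 0].
have mZ : measurable Z.
  by rewrite -[X in measurable X]setTI; exact: (mg measurableT [set 0]).
have mK : measurable_fun [set: Omega] (K g) by exact: (measurable_evp_op env).
have K0 w : 0 <= K g w by exact: (evp_op_ge0 env).
have IK := integral_evp_op env lawP stat mg g0.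
have split_int f : measurable_fun [set: Omega] f -> (forall w, 0 <= f w) ->
    \int[Pistar]_w f w = \int[Pistar]_(w in Z) f w + \int[Pistar]_(w in ~` Z) f w.
  move=> mf f0; rewrite -ge0_integral_setU ?setUv//; first exact: measurableC.
  by apply/disj_setPS; rewrite setICr.
have : {ae Pistar, forall w, Z w -> K g w = 0}.
  apply: ge0_integral_eq0_ae => //; first exact: measurable_funTS.
  (* All the mass of [g] sits off [Z], where K g already dominates it. The total integrals being
     equal and finite, K g has no mass left on [Z]. *)
  have IgZ : \int[Pistar]_w g w = \int[Pistar]_(w in ~` Z) g w.
    by rewrite (split_int g)// integral0_eq ?add0e.
  have fK : \int[Pistar]_(w in ~` Z) K g w \is a fin_num.
    rewrite ge0_fin_numE ?integral_ge0//; apply: le_lt_trans Ig.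
    by rewrite -IK (split_int (K g))// leeDr// integral_ge0.
  rewrite -(leeD2rE _ _ fK) add0e -split_int// IK IgZ.
  apply: ae_ge0_le_integral => //.
  - exact: measurableC.
  - exact: measurable_funTS.
  - exact: measurable_funTS.
  - by apply: filterS gK.
apply: filterS => w KZ /KZ Kw y py; apply/eqP; rewrite eq_le g0 andbT.
have : (p w 0 y)%:E * g (tau y w) <= 0.
  rewrite -Kw; apply: (esum_ge_term y) => z; exact: (jump_ge0 env).
by rewrite pmule_rle0.
Qed.

(** From almost every point of [B] all jumps stay in [B], so K maps the indicator of [B] to 1 there:
    the indicator is subharmonic, and its zero set is the complement. *)
Lemma ae_jump_closedC B : measurable B -> ae_jump_closed B ->
  ae_jump_closed (~` B).
Proof.
move=> mB Bcl.
have -> : ~` B = [set w | (EFin \o \1_B : Omega -> \bar R) w = 0].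
  apply/seteqP; split => w /=; first by move=> nB; rewrite indicE memNset.
  by rewrite indicE => -[] /eqP; rewrite pnatr_eq0 eqb0 notin_setE.
have pos1 w : 0 <= (EFin \o \1_B) w :> \bar R by rewrite lee_fin.
apply: subharmonic_zero => //.
- by apply/measurable_EFinP; exact: measurable_indic.
- by rewrite integral_indic// setIT -ge0_fin_numE ?fin_num_measure.
move: Bcl; rewrite /ae_jump_closed; apply: filterS => w Bw.
have [wB|wB] := pselect (B w); last first.
  by rewrite /= indicE memNset// (evp_op_ge0 env).
rewrite /= indicE mem_set// -(env_sum1 env w 0%R); apply: le_esum => y _.
have := env_ge0 env w 0%R y; rewrite le_eqVlt => /orP[/eqP <-|py].
  by rewrite mul0e.
by rewrite /= indicE mem_set ?mule1//; exact: Bw.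
Qed.

(** Since [Pistar] charges Omega_t, it charges the part of Omega_t inside [B] or the part
    outside. *)
Lemma ae_jump_closed_dichotomy B : measurable B -> ae_jump_closed B ->
  Pi B = 1 \/ Pi (~` B) = 1.
Proof.
move=> mB Bcl; have mT := measurable_transitive_envs.
have mC : measurable (~` B) by exact: measurableC.
have [BT|BT] := ltP 0 (Pistar (B `&` transitive_envs p Gamma)).
  by left; exact: ae_jump_closed_full.
right; apply: ae_jump_closed_full => //; first exact: ae_jump_closedC.
have := steady_transitive steady.
rewrite -[in X in X -> _](setUIDK (transitive_envs p Gamma) B) measureU//.
- move=> /lt_le_trans; apply; rewrite setDE setIC [X in _ + Pistar X]setIC.
  by rewrite -[leRHS]add0e leeD2r.
- exact: measurableI.
- exact: measurableD.
- by rewrite setDE setIACA setICr setI0.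
Qed.

(** This is Pi << Pi_*. The complement of a [Pistar]-null set is closed under almost all jumps, so
    it has [Pi]-mass 1 or 0; mass 0 would make it [Pistar]-null too, by absolute continuity. *)
Lemma environment_dominated_by_steady Q :
  {ae Pistar, forall w, Q w} -> {ae Pi, forall w, Q w}.
Proof.
move=> aeQ; have [N [mN N0 QN]] := aeQ.
have mC : measurable (~` N) by exact: measurableC.
have aeN : {ae Pistar, forall w, ~ N w} by exists N; split => // w /contrapT.
suff : Pi (~` N) = 1.
  by move/(ae_probability1 _ mC); apply: filterS => w; apply: contra_notP => /QN.
have clN : ae_jump_closed (~` N) by apply: filterS (ae_jump aeN) => w + _.
have [//|] := ae_jump_closed_dichotomy mC clN.
rewrite setCK => N1; have : Pi (~` N) = 0.
  by rewrite probability_setC// N1 subee.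
move=> N0'; have : Pistar (~` N) = 0.
  exact: null_dominates_measurable (steady_ac steady) mC N0'.
rewrite probability_setC// N0 sube0 => /eqP.
by rewrite onee_eq0.
Qed.

Lemma steady_dominated_by_environment Q :
  {ae Pi, forall w, Q w} -> {ae Pistar, forall w, Q w}.
Proof.
move=> [N [mN N0 QN]]; exists N; split => //.
exact: null_dominates_measurable (steady_ac steady) mN N0.
Qed.

End environment_ergodicity.

Lemma ae_eq0_of_integral d (T : measurableType d) (R : realType)
    (mu : {measure set T -> \bar R}) (f : T -> R) :
  measurable_fun [set: T] f -> (\int[mu]_x (f x)%:E = 0)%E ->
  {ae mu, forall x, 0 <= f x} -> {ae mu, forall x, f x = 0}.
Proof.
move=> mf If f0; have mEf : measurable_fun [set: T] (EFin \o f) by exact/measurable_EFinP.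
have If0 : (\int[mu]_x `|(EFin \o f) x| = 0)%E.
  rewrite -If; apply: ae_eq_integral => //; first exact: measurableT_comp.
  by apply: filterS f0 => x fx _; rewrite /= ger0_norm.
have := (ae_eq_integral_abs mu measurableT mEf).1 If0.
by apply: filterS => x /(_ I) [].
Qed.

(** * Bounded harmonic functions of the environment chain *)

Section harmonic.
Local Open Scope ereal_scope.
Context (R : realType) (d : nat) (disp : measure_display)
  (Omega : measurableType disp) (Pi : probability Omega R)
  (p : Omega -> lattice d -> lattice d -> R)
  (tau : lattice d -> Omega -> Omega)
  (Gamma : set (lattice d))
  (Pistar : probability Omega R)
  (P : Omega -> probability (path_space d) R).
Hypothesis env : random_environment Pi p tau.
Hypothesis lawP : forall w, is_walk_law (p w) (P w).
Hypothesis Gamma_subgroup : zmod_closed (mem Gamma).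
Hypothesis erg : ergodic Pi tau Gamma.
Hypothesis steady : ac_steady_state Pi p tau Gamma Pistar.

Lemma harmonic_constant (h : Omega -> R) :
  measurable_fun [set: Omega] h -> (forall w, 0 <= h w <= 1)%R ->
  (forall w, evp_op p tau (EFin \o h) w = (h w)%:E) ->
  exists2 t : R, (0 <= t)%R & {ae Pistar, forall w, h w = t}.
Proof.
move=> mh h01 hK.
have h0 w : (0 <= h w)%R by have /andP[] := h01 w.
have intbnd (g : Omega -> R) : measurable_fun [set: Omega] g ->
    (forall w, 0 <= g w <= 1)%R -> Pistar.-integrable setT (EFin \o g).
  move=> mg g01.
  apply: (le_integrable _ _ _
    (finite_measure_integrable_cst Pistar 1%R _)) => //.
    exact/measurable_EFinP.
  move=> w _ /=; rewrite lee_fin normr1.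
  by have /andP[g0 g1] := g01 w; rewrite ger0_norm.
have ih := intbnd h mh h01.
have Ih : \int[Pistar]_w (h w)%:E \is a fin_num by exact: integrable_fin_num.
pose t := fine (\int[Pistar]_w (h w)%:E).
have t0 : (0 <= t)%R by apply/fine_ge0/integral_ge0 => w _; rewrite lee_fin.
have ct : Pistar.-integrable setT (EFin \o cst t).
  exact: finite_measure_integrable_cst.
(* [(h - t)^+] is subharmonic, so [h <= t] is closed under almost all jumps. Once
   it or its complement has full measure, [h - t] has a constant sign and mean 0. *)
exists t => //.
pose g w := Num.max (h w - t)%R 0%R.
have mg : measurable_fun [set: Omega] g.
  by apply: measurable_maxr => //; exact: measurable_funB.
have g01 w : (0 <= g w <= 1)%R.
  rewrite le_max lexx orbT ge_max ler01 andbT /=.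
  by have /andP[_ h1] := h01 w; rewrite lerBlDr (le_trans h1)// lerDl.
have g0 w : (0 <= g w)%R by have /andP[] := g01 w.
have cl : ae_jump_closed p tau Pistar [set w | (h w <= t)%R].
  rewrite (_ : [set w | _] = [set w | (g w)%:E = 0]); last first.
    apply/seteqP; split => w /=; rewrite /g.
      by move=> ht; congr EFin; apply/max_idPr; rewrite subr_le0.
    by move=> [/max_idPr]; rewrite subr_le0.
  apply: (subharmonic_zero env lawP steady).
  - exact/measurable_EFinP.
  - by move=> w; rewrite lee_fin.
  - rewrite -ge0_fin_numE; last by apply: integral_ge0 => w _; rewrite lee_fin.
    exact: integrable_fin_num (intbnd g mg g01).
  apply: aeW => w.
  have Kg0 : 0 <= evp_op p tau (fun w => (g w)%:E) w.
    by apply: (evp_op_ge0 env) => ?; rewrite lee_fin.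
  (* To show K h <= K g + t without subtracting sums, write [t] as [t] times the sum of the
     transition probabilities and compare term by term. *)
  rewrite /g EFin_max ge_max Kg0 andbT EFinB leeBlDr// -hK.
  rewrite -[t%:E]mule1 -(env_sum1 env w 0%R) -ge0_esumZl//; last first.
    by move=> y; rewrite lee_fin (env_ge0 env).
  rewrite -esumD; last 2 first.
  - move=> y _; apply: mule_ge0; rewrite lee_fin ?(env_ge0 env)//; exact: g0.
  - by move=> y _; apply: mule_ge0; rewrite lee_fin ?(env_ge0 env).
  apply: le_esum => y _ /=; rewrite -!EFinM -EFinD lee_fin.
  rewrite [X in (_ <= _ + X)%R]mulrC -mulrDr ler_wpM2l ?(env_ge0 env)//.
  by rewrite -lerBlDr le_max lexx.
have mB : measurable [set w | (h w <= t)%R].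
  rewrite -[X in measurable X]setTI -preimage_itvNyc; exact: mh.
have dich := ae_jump_closed_dichotomy env lawP Gamma_subgroup erg steady mB cl.
have I0 : \int[Pistar]_w (h w - t)%:E = 0.
  under eq_integral do rewrite EFinB.
  rewrite (@integralB_EFin _ _ _ Pistar setT h (cst t))//.
  have -> : \int[Pistar]_w (cst t w)%:E = t%:E.
    rewrite (@integral_cst _ _ _ Pistar setT _ t%:E)//.
    by have := @probability_setT _ _ _ Pistar => /= ->; rewrite mule1.
  by rewrite /t fineK// subee.
have mht : measurable_fun [set: Omega] (fun w => h w - t)%R by exact: measurable_funB.
have aePi (Q : Omega -> Prop) : {ae Pi, forall w, Q w} -> {ae Pistar, forall w, Q w}.
  exact: (steady_dominated_by_environment steady).
case: dich => [/(ae_probability1 _ mB)/aePi ht|].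
  have : {ae Pistar, forall w, - (h w - t) = 0}%R.
    apply: ae_eq0_of_integral.
    - exact: measurable_funN.
    - under eq_integral do rewrite EFinN.
      rewrite integralN ?I0 ?oppe0// .
      apply: integrable_add_def => //.
      rewrite (_ : (fun w => (h w - t)%:E) = (EFin \o h) \- (EFin \o cst t)); last first.
        by apply/funext => w /=; rewrite EFinB.
      exact: integrableB.
    - by apply: filterS ht => w; rewrite oppr_ge0 subr_le0.
  by apply: filterS => w /eqP; rewrite oppr_eq0 subr_eq0 => /eqP.
move/(ae_probability1 _ (measurableC mB))/aePi => ht.
have : {ae Pistar, forall w, h w - t = 0}%R.
  apply: ae_eq0_of_integral => //.
  apply: filterS ht => w /=; rewrite subr_ge0.
  by move/negP; rewrite -ltNge => /ltW.
by apply: filterS => w /eqP; rewrite subr_eq0 => /eqP.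
Qed.

End harmonic.

(** * Maximal ergodic lemma *)

Section maximal_ergodic.
Local Open Scope ereal_scope.
Context d (T : measurableType d) (R : realType).
Variables (mu : {measure set T -> \bar R}) (theta : T -> T).
Hypothesis mtheta : measurable_fun [set: T] theta.
Hypothesis theta_inv : forall E, measurable E -> mu (theta @^-1` E) = mu E.

Lemma ge0_integral_invariant (A : set T) (g : T -> \bar R) :
  measurable A -> measurable_fun [set: T] g -> (forall x, 0 <= g x) ->
  \int[mu]_(x in theta @^-1` A) g (theta x) = \int[mu]_(x in A) g x.
Proof.
move=> mA mg g0.
rewrite -[LHS](@ge0_integral_pushforward _ _ _ _ _ theta mtheta mu A g)//.
- by apply: eq_measure_integral => E mE _; exact: theta_inv.
- exact: measurable_funTS.
Qed.

Variables (f : T -> R) (A : set T).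
Hypothesis intf : mu.-integrable [set: T] (EFin \o f).
Hypothesis mA : measurable A.
Hypothesis A_inv : theta @^-1` A = A.
Hypothesis A_unbounded : forall x, A x -> forall C : R,
  exists n : nat, (C < \sum_(k < n) f (iter k theta x))%R.

(** The recursion yields the maximum of the Birkhoff sums of length at most [n], the empty sum
    included. *)
Fixpoint running_max (n : nat) (x : T) : R :=
  if n is n'.+1 then Num.max 0%R (f x + running_max n' (theta x))%R else 0%R.

Let M := running_max.

Let M_ge0 n x : (0 <= M n x)%R.
Proof. by case: n => //= n; rewrite le_max lexx. Qed.

Let M_homo n x : (M n x <= M n.+1 x)%R.
Proof.
elim: n x => [x|n IHn x] /=; first by rewrite le_max lexx.
rewrite ge_max le_max lexx /= le_max; apply/orP; right.
by rewrite lerD2l; exact: IHn.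
Qed.

Let M_ge n x : (\sum_(k < n) f (iter k theta x) <= M n x)%R.
Proof.
elim: n x => [x|n IHn x]; first by rewrite big_ord0.
rewrite big_ord_recl /= le_max lerD2l; apply/orP; right.
apply: le_trans (IHn (theta x)); rewrite le_eqVlt; apply/orP; left; apply/eqP.
by apply: eq_bigr => i _; rewrite -iterSr.
Qed.

Let mf : measurable_fun [set: T] f.
Proof. by apply/measurable_EFinP; exact: measurable_int intf. Qed.

Let mM n : measurable_fun [set: T] (M n).
Proof.
elim: n => [|n IHn]; first exact: measurable_cst.
apply: measurable_maxr; first exact: measurable_cst.
by apply: measurable_funD => //; exact: (measurableT_comp IHn).
Qed.

Let mMtheta n : measurable_fun [set: T] (M n \o theta).
Proof. exact: (measurableT_comp (mM n)). Qed.

Let intM_theta n : mu.-integrable [set: T] (EFin \o M n) ->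
  mu.-integrable [set: T] (EFin \o (M n \o theta)).
Proof.
move=> /integrableP[_ iM]; apply/integrableP; split; first exact/measurable_EFinP.
rewrite -[X in X < _](_ : \int[mu]_(x in theta @^-1` setT) `|(M n (theta x))%:E| = _).
  rewrite (@ge0_integral_invariant setT (fun x => `|(M n x)%:E|))//.
  by apply: measurableT_comp => //; exact/measurable_EFinP.
by rewrite preimage_setT.
Qed.

Let intM n : mu.-integrable [set: T] (EFin \o M n).
Proof.
elim: n => [|n IHn].
  exact: (@integrable0 _ _ _ mu setT).
have iD : mu.-integrable [set: T] ((EFin \o f) \+ (EFin \o (M n \o theta))).
  by apply: integrableD => //; exact: intM_theta.
apply: le_integrable iD => //; first exact/measurable_EFinP.
move=> x _; rewrite /= lee_fin ger0_norm ?le_max ?lexx//.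
by rewrite ge_max normr_ge0 ler_norm.
Qed.

(* [gap n] is [running_max n.+1 - running_max n \o theta]: its integral over [A]
   is nonnegative by invariance, and on [A] it decreases to [f]. *)
Let gap n x := Num.max (- M n (theta x))%R (f x).

Let gapE n x : gap n x = (M n.+1 x - M n (theta x))%R.
Proof. by rewrite /gap /= addr_maxl sub0r addrK. Qed.

Let integral_gap_ge0 n : 0 <= \int[mu]_(x in A) (gap n x)%:E.
Proof.
have iS k : mu.-integrable A (EFin \o M k) by exact: integrableS (intM k).
have iT : mu.-integrable A (EFin \o (M n \o theta)).
  by apply: integrableS (intM_theta (intM n)).
under eq_integral do rewrite gapE EFinB.
rewrite (@integralB_EFin _ _ _ mu A (M n.+1) (M n \o theta))//.
have -> : \int[mu]_(x in A) ((M n \o theta) x)%:E = \int[mu]_(x in A) (M n x)%:E.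
  rewrite -[in LHS]A_inv.
  apply: (@ge0_integral_invariant A (EFin \o M n)) => //.
    exact/measurable_EFinP.
  by move=> x; rewrite lee_fin.
rewrite sube_ge0; last first.
  by rewrite integrable_fin_num//; exact: iS.
apply: ge0_le_integral => //.
- by move=> x _; rewrite lee_fin.
- by apply/measurable_EFinP; exact: measurable_funTS.
- by apply/measurable_EFinP; exact: measurable_funTS.
- by move=> x _; rewrite lee_fin.
Qed.

(** On [A] the gap is eventually equal to [f], and it always lies between [f] and [|f|], so
    dominated convergence passes its nonnegative integral to the limit. *)
Lemma maximal_ergodic : 0 <= \int[mu]_(x in A) (f x)%:E.
Proof.
have iA : mu.-integrable A (EFin \o f) by exact: integrableS intf.
have [] := @dominated_convergence _ _ _ mu A mA (fun n => EFin \o gap n)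
  (EFin \o f) (abse \o (EFin \o f)).
- move=> n; apply/measurable_EFinP; apply: measurable_funTS.
  rewrite /gap; apply: (measurable_maxr _ mf); exact: (measurable_funN (mMtheta n)).
- exact/measurable_EFinP/measurable_funTS.
(* Once a Birkhoff sum at [theta x] exceeds [- f x], the maximum defining the gap is [f x] for all
   later indices. *)
- apply: aeW => x Ax; have Atx : A (theta x) by rewrite -A_inv in Ax.
  have [n Mn] := A_unbounded Atx (- f x)%R.
  apply: cvg_near_cst; exists n => // m /= nm; congr EFin.
  apply/max_idPr; rewrite lerNl; apply: (le_trans (ltW Mn)).
  apply: (le_trans (M_ge n _)).
  elim: m nm => [|m IHm]; first by rewrite leqn0 => /eqP ->.
  rewrite leq_eqVlt => /orP[/eqP -> //|]; rewrite ltnS => /IHm /le_trans; apply.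
  exact: M_homo.
- exact: integrable_abse.
- apply: aeW => x n Ax; rewrite /= lee_fin /gap.
  have [ffM|fM] := leP (f x) (- M n (theta x))%R; last by [].
  rewrite normrN ger0_norm// -[leRHS]normrN (le_trans _ (ler_norm _))//.
  by rewrite lerNr.
move=> _ _ cvgf; rewrite -(cvg_lim _ cvgf)//.
apply: lime_ge; first exact: cvgP cvgf.
by apply: nearW => n; exact: integral_gap_ge0.
Qed.

End maximal_ergodic.

(** * Speed of the walk *)

(** Natural thresholds suffice for unboundedness above and keep the event a countable combination of
    events on single positions. *)
Definition escape (R : realType) (d : nat) (phi : lattice d -> R) (c : R) :
    set (path_space d) :=
  [set X | forall m : nat, exists n : nat,
    m%:R < phi ((X : nat -> lattice d) n) - n%:R * c].

Section speed_bound.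
Context (R : realType) (d : nat) (phi : lattice d -> R) (c : R).
Hypothesis phiB : forall x y, phi (x - y) = phi x - phi y.

Lemma measurable_escape : measurable (escape phi c).
Proof.
rewrite (_ : escape phi c = \bigcap_(m in setT) \bigcup_(n in setT)
    ((fun X : path_space d => (X : nat -> lattice d) n) @^-1`
      [set x | m%:R < phi x - n%:R * c])).
  apply: countable_bigcap_measurable => m.
  apply: countable_bigcup_measurable => n.
  exact: (@measurable_preimage_discrete _ (path_space d) _
    (fun X : path_space d => (X : nat -> lattice d) n) (@measurable_visit d n)).
apply/seteqP; split => X AX m; first by move=> _; have [n ?] := AX m; exists n.
by have [n _ ?] := AX m I; exists n.
Qed.

Lemma escapeP X (C : R) : escape phi c X ->
  exists n : nat, C < phi ((X : nat -> lattice d) n.+1) - n.+1%:R * c.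
Proof.
(* A threshold above [phi] of the starting point excludes time 0. *)
move=> /(_ (Num.truncn `|Num.max C (phi ((X : nat -> lattice d) 0%N))|).+1) [n].
move=> /(lt_trans (truncnS_gt _)) /(le_lt_trans (ler_norm _)).
rewrite gt_max => /andP[Cn]; case: n Cn => [|n Cn _]; last by exists n.
by rewrite mul0r subr0 ltxx.
Qed.

(** Up to a shift of time by one, the two deviations differ by the constant [phi (X 1) - c], which
    does not affect unboundedness. The equality is exact, as the maximal lemma asks. *)
Lemma path_shift_escape : @path_shift d @^-1` escape phi c = escape phi c.
Proof.
apply/seteqP; split => X AX m.
  have [n] := escapeP (m%:R - (phi ((X : nat -> lattice d) 1%N) - c)) AX.
  rewrite /path_shift phiB => mn; exists n.+2.
  rewrite -[n.+2%:R]natr1 mulrDl mul1r; lra.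
have [n] := escapeP (m%:R + (phi ((X : nat -> lattice d) 1%N) - c)) AX.
move=> mn; exists n; rewrite /path_shift phiB.
by move: mn; rewrite -[n.+1%:R]natr1 mulrDl mul1r; lra.
Qed.

(** Recentrings telescope. At least one shift is made, since [X] itself may start away from 0. *)
Lemma iter_path_shift k (X : path_space d) n :
  (iter k.+1 (@path_shift d) X : nat -> lattice d) n =
  (X : nat -> lattice d) (n + k.+1)%N - (X : nat -> lattice d) k.+1.
Proof.
elim: k n => [|k IHk] n; first by rewrite addn1.
transitivity ((iter k.+1 (@path_shift d) X : nat -> lattice d) n.+1 -
  (iter k.+1 (@path_shift d) X : nat -> lattice d) 1%N); first by [].
by rewrite !IHk addSnnS add1n opprB addrA subrK.
Qed.

(** The term [k = 0] is [phi (X 1) - c], not an increment from [X 0]; so the sum telescopes for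
    every trajectory, provided it has at least one term. *)
Lemma sum_increments (X : path_space d) n :
  \sum_(k < n.+1) (phi ((iter k (@path_shift d) X : nat -> lattice d) 1%N) - c) =
  phi ((X : nat -> lattice d) n.+1) - n.+1%:R * c.
Proof.
elim: n => [|n IHn]; first by rewrite big_ord_recr big_ord0 /= add0r mul1r.
rewrite big_ord_recr IHn /= -iterS iter_path_shift phiB add1n.
by rewrite -[n.+2%:R]natr1 mulrDl mul1r; lra.
Qed.

End speed_bound.

(** * Escape events are null in almost every environment *)

Section speed_in_environment.
Local Open Scope ereal_scope.
Context (R : realType) (d : nat) (disp : measure_display)
  (Omega : measurableType disp) (Pi : probability Omega R)
  (p : Omega -> lattice d -> lattice d -> R)
  (tau : lattice d -> Omega -> Omega)
  (Gamma : set (lattice d))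
  (Pistar : probability Omega R)
  (P : Omega -> probability (path_space d) R).
Hypothesis env : random_environment Pi p tau.
Hypothesis lawP : forall w, is_walk_law (p w) (P w).
Hypothesis Gamma_subgroup : zmod_closed (mem Gamma).
Hypothesis erg : ergodic Pi tau Gamma.
Hypothesis steady : ac_steady_state Pi p tau Gamma Pistar.

Let stat := steady_stationary steady.
Let Q := averaged_law Pistar env lawP.
Let step (X : path_space d) : lattice d := (X : nat -> lattice d) 1%N.

Let measurable_step y : measurable (step @^-1` [set y]).
Proof. exact: measurable_visit. Qed.

Lemma averaged_integral_step (psi : lattice d -> \bar R) : (forall y, 0 <= psi y) ->
  \int[Q]_X psi (step X) =
  \int[Pistar]_w \esum_(y in [set: lattice d]) ((p w 0%R y)%:E * psi y).
Proof.
move=> psi0; rewrite -[LHS]/(giry_int _ _) giry_int_bind//.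
  apply: eq_integral => w _; rewrite /giry_int.
  exact: (walk_integral_step lawP).
exact: (@measurable_fun_discrete _ _ _ setT step).
Qed.

Variables (phi : lattice d -> R) (c : R).
Hypothesis phiB : forall x y, phi (x - y)%R = (phi x - phi y)%R.
Hypothesis phi_int : Q.-integrable setT (fun X => (phi (step X))%:E).
Hypothesis phi_lt : \int[Q]_X (phi (step X))%:E < c%:E.

Local Notation A := (escape phi c).

Let mA : measurable A. Proof. exact: measurable_escape. Qed.

Lemma escape_step w y : P w (A `&` step @^-1` [set y]) =
  (p w 0%R y)%:E * P (tau y w) A.
Proof.
rewrite -(walk_markov env lawP)// setIC; congr (P w _).
by rewrite (path_shift_escape c phiB).
Qed.

Lemma escape_null : {ae Pi, forall w, P w A = 0}.
Proof.
pose h w := fine (P w A).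
have hE w : (h w)%:E = P w A by rewrite /h fineK// fin_num_measure.
(* Shift-invariance of [A] makes its quenched probability harmonic. *)
have [t t0 ht] : exists2 t : R, (0 <= t)%R & {ae Pistar, forall w, h w = t}.
  apply: (harmonic_constant env lawP Gamma_subgroup erg steady).
  - apply/measurable_EFinP; apply: (eq_measurable_fun (fun w => P w A)).
      by move=> w _; rewrite /= hE.
    exact: (measurable_walk_law env lawP).
  - move=> w; rewrite -!lee_fin hE measure_ge0 /=; exact: probability_le1.
  - move=> w; rewrite hE -(path_shift_escape c phiB) (walk_law_shift env lawP)//.
    by apply: eq_esum => y _; rewrite /= hE.
(* Given a first step to [y], the probability of [A] is [h (tau y w)], which is [t] for almost every
   [w] and every possible [y]. Under [Q] the event [A] is thus independent of the first step. *)
have QA (psi : lattice d -> \bar R) : (forall y, 0 <= psi y) ->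
    \int[Q]_(X in A) psi (step X) = t%:E * \int[Q]_X psi (step X).
  move=> psi0.
  rewrite (@ge0_integral_discrete _ _ _ _ Q A step)//.
  rewrite (@ge0_integral_discrete _ _ _ _ Q setT step)//.
  rewrite -ge0_esumZl//; last by move=> y; rewrite mule_ge0.
  apply: eq_esum => y _; rewrite muleCA; congr (_ * _); rewrite setTI.
  transitivity (\int[Pistar]_w P w (A `&` step @^-1` [set y])).
    by apply: averaged_lawE; exact: measurableI.
  transitivity (t%:E * \int[Pistar]_w P w (step @^-1` [set y])); last first.
    by congr (_ * _); apply/esym; exact: averaged_lawE.
  rewrite -ge0_integralZl//; last exact: (measurable_walk_law env lawP).
  apply: ae_eq_integral => //.
  - by apply: (measurable_walk_law env lawP); exact: measurableI.
  - by apply: measurable_funeM; exact: (measurable_walk_law env lawP).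
  have := ae_jump env lawP steady ht; apply: filterS => w htau _.
  rewrite escape_step -hE (_ : P w _ = (p w 0%R y)%:E); last first.
    exact: walk_step (lawP w) y.
  have := env_ge0 env w 0%R y; rewrite le_eqVlt => /orP[/eqP <-|py].
    by rewrite mul0e mule0.
  by rewrite htau// muleC.
pose f X := (phi (step X) - c)%R.
have intf : Q.-integrable setT (EFin \o f).
  rewrite (_ : EFin \o f = (fun X => (phi (step X))%:E) \- (EFin \o cst c)).
    by apply: integrableB => //; exact: finite_measure_integrable_cst.
  by apply/funext => X; rewrite /= EFinB.
have Ic : \int[Q]_X (cst c X)%:E = c%:E.
  transitivity (c%:E * Q setT); first exact: (integral_cst Q measurableT c%:E).
  rewrite -[RHS]mule1; congr (_ * _).
  transitivity (\int[Pistar]_w P w setT); first exact: averaged_lawE.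
  under eq_integral do rewrite probability_setT.
  by rewrite integral_cst// mul1e; exact: probability_setT.
have If : \int[Q]_X (f X)%:E < 0.
  under eq_integral do rewrite EFinB.
  rewrite (@integralB_EFin _ _ _ Q setT _ (cst c))//; last first.
    exact: finite_measure_integrable_cst.
  by rewrite Ic sube_lt0 ?orbT//.
(* [QA] handles nonnegative functions, so positive and negative parts are treated separately. *)
have IA : \int[Q]_(X in A) (f X)%:E = t%:E * \int[Q]_X (f X)%:E.
  have Ipos : \int[Q]_(X in A) (fun X => (f X)%:E)^\+ X =
      t%:E * \int[Q]_X (fun X => (f X)%:E)^\+ X.
    have pos0 y : 0 <= maxe (phi y - c)%:E 0 by rewrite le_max lexx orbT.
    under eq_integral do rewrite funeposE.
    under [in RHS]eq_integral do rewrite funeposE.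
    exact: (QA _ pos0).
  have Ineg : \int[Q]_(X in A) (fun X => (f X)%:E)^\- X =
      t%:E * \int[Q]_X (fun X => (f X)%:E)^\- X.
    have neg0 y : 0 <= maxe (- (phi y - c)%:E) 0 by rewrite le_max lexx orbT.
    under eq_integral do rewrite funenegE.
    under [in RHS]eq_integral do rewrite funenegE.
    exact: (QA _ neg0).
  transitivity (t%:E * (\int[Q]_X (fun X => (f X)%:E)^\+ X -
                        \int[Q]_X (fun X => (f X)%:E)^\- X)).
    rewrite muleBr//; first by rewrite [LHS]integralE Ipos Ineg.
    exact: (integrable_add_def measurableT intf).
  by congr (_ * _); rewrite [RHS]integralE.
have unbounded X : A X -> forall C : R,
    exists n : nat, (C < \sum_(k < n) f (iter k (@path_shift d) X))%R.
  move=> AX C; have [n Cn] := escapeP C AX; exists n.+1.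
  by rewrite (sum_increments _ phiB).
have := maximal_ergodic (@measurable_path_shift d)
  (averaged_law_shift env lawP stat) intf mA (path_shift_escape c phiB) unbounded.
rewrite IA => If0; have : (t <= 0)%R.
  by rewrite leNgt; apply: contraTN If0 => tpos; rewrite -ltNge pmule_rlt0.
move=> tle0; have {tle0} t00 : t = 0%R by apply/eqP; rewrite eq_le tle0.
apply: (environment_dominated_by_steady env lawP Gamma_subgroup erg steady).
by apply: filterS ht => w; rewrite -hE t00 => ->.
Qed.

End speed_in_environment.

Lemma normr_le_euclid (R : realType) (d : nat) (y : lattice d) (i : 'I_d) :
  `|to_Rd R y 0 i| <= euclid R y.
Proof.
rewrite /euclid -sqrtr_sqr mxE ler_sqrt; last first.
  by apply: sumr_ge0 => j _; exact: sqr_ge0.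
rewrite (bigD1 i)//= lerDl.
by apply: sumr_ge0 => j _; exact: sqr_ge0.
Qed.

Lemma escapeN_bound (R : realType) (d : nat) (phi : lattice d -> R) (c : R) X :
  ~ escape phi c X ->
  exists m : nat, forall n : nat,
    phi ((X : nat -> lattice d) n) <= n%:R * c + m%:R.
Proof.
move=> /existsNP[m /forallNP Xm]; exists m => n.
by have /negP := Xm n; rewrite -leNgt lerBlDl.
Qed.

(** Half of [e] absorbs the excess slope [1/(k+1)], the other half absorbs [m/n] for large [n]. *)
Lemma speed_le_near (R : realType) (u : nat -> R) (v : R) :
  (forall k : nat, exists m : nat, forall n : nat,
    u n <= n%:R * (v + k.+1%:R^-1) + m%:R) ->
  forall e, 0 < e -> \forall n \near \oo, n%:R^-1 * u n < v + e.
Proof.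
move=> ub e e0; have e20 : 0 < e / 2 by rewrite divr_gt0.
pose k := Num.truncn (e / 2)^-1.
have ke : k.+1%:R^-1 < e / 2.
  by rewrite invf_plt ?posrE// truncnS_gt.
have [m mub] := ub k.
near=> n.
have n0 : 0 < n%:R :> R by rewrite ltr0n; near: n; exact: nbhs_infty_gt.
have nm : m%:R / (e / 2) < n%:R by near: n; exact: nbhs_infty_gtr.
rewrite mulrC ltr_pdivrMr//; apply: le_lt_trans (mub n) _.
move: nm; rewrite ltr_pdivrMr// => nm.
have : n%:R * k.+1%:R^-1 < n%:R * (e / 2) by rewrite ltr_pM2l.
move: nm; move: (n%:R) (m%:R) (k.+1%:R^-1) => N M r; nra.
Unshelve. all: by end_near.
Qed.

(** * The mean first step is the averaged local drift *)

Section drift_average.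
Local Open Scope ereal_scope.
Context (R : realType) (d : nat) (disp : measure_display)
  (Omega : measurableType disp) (Pi : probability Omega R)
  (p : Omega -> lattice d -> lattice d -> R)
  (tau : lattice d -> Omega -> Omega)
  (Pistar : probability Omega R)
  (P : Omega -> probability (path_space d) R).
Hypothesis env : random_environment Pi p tau.
Hypothesis lawP : forall w, is_walk_law (p w) (P w).
Hypothesis drift_L1 : drift_in_L1 Pistar p.

Let Q := averaged_law Pistar env lawP.
Variable i : 'I_d.
Let phi (y : lattice d) : R := (to_Rd R y 0 i)%R.

Let sum_jumps (psi : lattice d -> \bar R) w :=
  \esum_(y in [set: lattice d]) ((p w 0%R y)%:E * psi y).

Let measurable_sum_jumps psi : (forall y, 0 <= psi y) ->
  measurable_fun [set: Omega] (sum_jumps psi).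
Proof.
move=> psi0; apply: ge0_measurable_esum => // [y|y w].
  by apply: (measurable_jump env y (g := cst (psi y))); exact: measurable_cst.
by rewrite mule_ge0// lee_fin (env_ge0 env).
Qed.

Let integral_sum_jumps_lty psi : (forall y, 0 <= psi y <= `|phi y|%:E) ->
  \int[Pistar]_w sum_jumps psi w < +oo.
Proof.
move=> psib; have psi0 y : 0 <= psi y by have /andP[] := psib y.
apply: le_lt_trans drift_L1; apply: ge0_le_integral => //.
- by move=> w _; apply: esum_ge0 => y _; rewrite mule_ge0// lee_fin (env_ge0 env).
- exact: measurable_sum_jumps.
- apply: (measurable_sum_jumps (psi := fun y => (euclid R y)%:E)) => y.
  by rewrite lee_fin sqrtr_ge0.
move=> w _; apply: le_esum => y _; rewrite EFinM lee_wpmul2l ?lee_fin ?(env_ge0 env)//.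
by have /andP[_ /le_trans] := psib y; apply; rewrite lee_fin normr_le_euclid.
Qed.

Let phip y : \bar R := maxe (phi y)%:E 0.
Let phin y : \bar R := maxe (- (phi y)%:E) 0.

Let phipb y : 0 <= phip y <= `|phi y|%:E.
Proof.
rewrite /phip le_max lexx orbT ge_max !lee_fin normr_ge0 andbT /=.
exact: ler_norm.
Qed.

Let phinb y : 0 <= phin y <= `|phi y|%:E.
Proof.
rewrite /phin le_max lexx orbT ge_max !lee_fin normr_ge0 andbT /=.
by rewrite -normrN ler_norm.
Qed.

Lemma integrable_coordinate_step :
  Q.-integrable setT (fun X => (phi ((X : nat -> lattice d) 1%N))%:E).
Proof.
apply/integrableP; split.
  apply/measurable_EFinP.
  apply: (@measurable_fun_discrete _ _ _ setT
    (fun X : path_space d => (X : nat -> lattice d) 1%N) _ _ _ _ phi) => //.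
  exact: measurable_visit.
have abs0 y : 0 <= `|phi y|%:E :> \bar R by rewrite lee_fin.
rewrite (averaged_integral_step Pistar env lawP abs0).
by apply: integral_sum_jumps_lty => y; rewrite abs0 lexx.
Qed.

Let drift_sum w : (drift p w 0 i)%R = fine (sum_jumps phip w - sum_jumps phin w).
Proof.
rewrite /drift mxE /rsum; congr (fine (_ - _)); apply: eq_esum => y _.
  rewrite funeposE /= EFinM /phip -[in LHS](mule0 (p w 0%R y)%:E) maxe_pMr//.
  by rewrite lee_fin (env_ge0 env).
rewrite funenegE /= EFinN EFinM /phin -muleN -[in LHS](mule0 (p w 0%R y)%:E) maxe_pMr//.
by rewrite lee_fin (env_ge0 env).
Qed.

Lemma integral_drift : (\int[Pistar]_w drift p w 0 i)%R%:E =
  \int[Q]_X (phi ((X : nat -> lattice d) 1%N))%:E.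
Proof.
have phip0 y : 0 <= phip y by have /andP[] := phipb y.
have phin0 y : 0 <= phin y by have /andP[] := phinb y.
have ints psi : (forall y, 0 <= psi y) -> (forall y, 0 <= psi y <= `|phi y|%:E) ->
    Pistar.-integrable setT (sum_jumps psi).
  move=> psi0 psib; apply/integrableP; split; first exact: measurable_sum_jumps.
  have sj0 w : 0 <= sum_jumps psi w.
    by apply: esum_ge0 => y _; rewrite mule_ge0// lee_fin (env_ge0 env).
  under eq_integral do rewrite gee0_abs//.
  exact: integral_sum_jumps_lty.
have ip := ints phip phip0 phipb.
have iN := ints phin phin0 phinb.
have IQ : \int[Q]_X (phi ((X : nat -> lattice d) 1%N))%:E =
    \int[Pistar]_w sum_jumps phip w - \int[Pistar]_w sum_jumps phin w.
  rewrite integralE; congr (_ - _).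
    under eq_integral do rewrite funeposE.
    exact: (averaged_integral_step Pistar env lawP phip0).
  under eq_integral do rewrite funenegE.
  exact: (averaged_integral_step Pistar env lawP phin0).
have ID : \int[Pistar]_w (drift p w 0 i)%R%:E =
    \int[Q]_X (phi ((X : nat -> lattice d) 1%N))%:E.
  rewrite IQ -integralB//; apply: ae_eq_integral => //.
  - under eq_fun do rewrite drift_sum.
    apply/measurable_EFinP; apply: (measurableT_comp (fine_measurable measurableT)).
    by apply: emeasurable_funB; exact: measurable_sum_jumps.
  - by apply: emeasurable_funB; exact: measurable_sum_jumps.
  (* The drift is defined through [fine], which is faithful only where both sums are finite;
     integrability ensures this almost everywhere. *)
  have := integrable_ae measurableT ip; have := integrable_ae measurableT iN.
  apply: filterS2 => w /(_ I) finn /(_ I) finp _.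
  by rewrite drift_sum fineK// fin_numB finp.
rewrite /Rintegral ID fineK// .
exact: (integrable_fin_num measurableT integrable_coordinate_step).
Qed.

End drift_average.

(** * Convergence of the speed *)

Theorem corollary1p5 (R : realType) (d : nat) (disp : measure_display)
    (Omega : measurableType disp) (Pi : probability Omega R)
    (p : Omega -> lattice d -> lattice d -> R)
    (tau : lattice d -> Omega -> Omega)
    (Gamma : set (lattice d))
    (Pistar : probability Omega R)
    (P : Omega -> probability (path_space d) R)
    (PP : probability (path_space d * Omega)%type R)
    (env : random_environment Pi p tau)
    (lawP : forall w, is_walk_law (p w) (P w))
    (lawPP : is_annealed_law Pi P PP)
    (Gamma_subgroup : zmod_closed (mem Gamma))
    (A1 : no_deterministic_walks p tau PP)
    (A2 : decaying Pi p)
    (A3 : ergodic Pi tau Gamma)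
    (A4 : partially_transitive Pi p Gamma)
    (A5 : ac_steady_state Pi p tau Gamma Pistar)
    (drift_L1 : drift_in_L1 Pi p)
    (drift_L1star : drift_in_L1 Pistar p) :
  {ae Pi, forall w, {ae P w, forall X : path_space d,
    (fun n : nat => n%:R^-1 *: to_Rd R ((X : nat -> lattice d) n)) @ \oo -->
    (\row_(i < d) (\int[Pistar]_w' drift p w' 0 i) : 'rV[R]_d)}}.
Proof.
pose phi (i : 'I_d) (y : lattice d) : R := to_Rd R y 0 i.
pose v (i : 'I_d) : R := \int[Pistar]_w' drift p w' 0 i.
have phiB i x y : phi i (x - y) = phi i x - phi i y.
  by rewrite /phi !mxE intrD intrN.
have phiNB i x y : (- phi i (x - y)) = (- phi i x) - (- phi i y).
  by rewrite phiB opprB opprK addrC.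
have phi_int i := integrable_coordinate_step env lawP drift_L1star i.
have vE i := integral_drift env lawP drift_L1star i.
(* Countably many slopes decreasing to the mean, so that the exceptional sets can be merged. *)
have up i k : {ae Pi, forall w, P w (escape (phi i) (v i + k.+1%:R^-1)) = 0%E}.
  apply: (escape_null (env := env) (lawP := lawP) Gamma_subgroup A3 A5 (phiB i) (phi_int i)).
  by rewrite -vE lte_fin ltrDl invr_gt0.
(* Lower bounds are upper bounds in the opposite direction, where the mean step is [- v i]. *)
have low i k : {ae Pi, forall w,
    P w (escape (fun y => - phi i y) (- v i + k.+1%:R^-1)) = 0%E}.
  apply: (escape_null (env := env) (lawP := lawP) Gamma_subgroup A3 A5 (phiNB i)).
    exact: (integrableN (phi_int i)).
  under eq_integral do rewrite EFinN.
  rewrite integralN; last exact: (integrable_add_def measurableT (phi_int i)).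
  by rewrite -vE -EFinN lte_fin ltrDl invr_gt0.
have upk : {ae Pi, forall w, forall i k,
    P w (escape (phi i) (v i + k.+1%:R^-1)) = 0%E}.
  by apply: filter_forall => i; apply: ae_foralln => k; exact: up.
have lowk : {ae Pi, forall w, forall i k,
    P w (escape (fun y => - phi i y) (- v i + k.+1%:R^-1)) = 0%E}.
  by apply: filter_forall => i; apply: ae_foralln => k; exact: low.
apply: filterS2 upk lowk => w upw loww.
have null_ae (A : set (path_space d)) : measurable A -> P w A = 0%E ->
    {ae P w, forall X, ~ A X}.
  by move=> mA A0; exists A; split => // X /contrapT.
have upX : {ae P w, forall X, forall i k, ~ escape (phi i) (v i + k.+1%:R^-1) X}.
  apply: filter_forall => i; apply: ae_foralln => k; apply: null_ae => //.
  exact: measurable_escape.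
have lowX : {ae P w, forall X, forall i k,
    ~ escape (fun y => - phi i y) (- v i + k.+1%:R^-1) X}.
  apply: filter_forall => i; apply: ae_foralln => k; apply: null_ae => //.
  exact: measurable_escape.
apply: filterS2 upX lowX => X upX lowX.
apply/cvg_ballP => e e0.
have coord i : \forall n \near \oo,
    `|v i - n%:R^-1 * phi i ((X : nat -> lattice d) n)| < e.
  have up_near := @speed_le_near _ (fun n => phi i ((X : nat -> lattice d) n)) _
    (fun k => escapeN_bound (upX i k)) e e0.
  have low_near := @speed_le_near _ (fun n => - phi i ((X : nat -> lattice d) n)) _
    (fun k => escapeN_bound (lowX i k)) e e0.
  near=> n; rewrite ltr_distlC.
  have un : n%:R^-1 * phi i ((X : nat -> lattice d) n) < v i + e by near: n.
  have ln : n%:R^-1 * - phi i ((X : nat -> lattice d) n) < - v i + e by near: n.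
  by rewrite mulrN in ln; apply/andP; split; lra.
(* Balls of row vectors are entrywise, so finitely many coordinate estimates suffice. *)
have := @filter_forall _ _ _ _ (@eventually_filter) coord.
apply: filterS => n Xn; split => // j i.
by rewrite [j]ord1 !mxE; have := Xn i; rewrite /phi mxE.
Unshelve. all: by end_near.
Qed.
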